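(* Let $L:S^n\to S^n$ be linear and monotone, let $Q\in S^n$, and suppose the semidefinite linear complementarity problem (find $X,Y\in S^n_+$ with $Y=L(X)+Q$ and $\mathrm{Tr}(XY)=0$) is strictly feasible. Consider the primal-dual interior point algorithm described in the context, based on the kernel function $\psi(t)=\frac12\left(2t^2+\frac1{t^2}-5\right)+e^{\frac1t-1}$, with threshold $\tau$, accuracy $\epsilon>0$, barrier update parameter $\theta\in(0,1)$, a strictly feasible starting pair $(X^0,Y^0)$ with $\mu^0=\mathrm{Tr}(X^0Y^0)/n$ and $\Psi(X^0,Y^0,\mu^0)\le\tau$, and the default step size $\tilde\alpha$. Put $\Psi_0=\frac{2}{1-\theta}\left(\sqrt{2\tau}+\sqrt n\,\theta\right)^2$. If $\tau\ge 1$, then the total number of (inner) iterations of the algorithm is not more than $$66\left(1+\log\left(2\sqrt{2\Psi_0}+1\right)\right)^2\,\Psi_0^{1/2}\,\frac1\theta\,\log\frac{n\mu^0}{\epsilon}.$$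
   Context: $S^n$ is the space of real symmetric $n\times n$ matrices, $S^n_+$ and $S^n_{++}$ the cones of positive semidefinite and positive definite ones; $\log$ is the natural logarithm. $L$ monotone means $\mathrm{Tr}(Z\,L(Z))\ge 0$ for all $Z\in S^n$. A pair $(X,Y)$ is strictly feasible if $X,Y\in S^n_{++}$ and $Y=L(X)+Q$; the problem is strictly feasible if such a pair exists. For $V\in S^n_{++}$ with eigenvalues $\lambda_1(V)\ge\dots\ge\lambda_n(V)>0$, $\psi(V)$ and $\psi'(V)$ are the matrix functions obtained by applying $\psi$, $\psi'$ to the eigenvalues, $\Psi(V)=\mathrm{Tr}(\psi(V))=\sum_i\psi(\lambda_i(V))$, and $\delta(V)=\frac12\|\psi'(V)\|_F=\frac12\sqrt{\mathrm{Tr}(\psi'(V)^2)}$. Scaling: for strictly feasible $(X,Y)$ and $\mu>0$ let $P=X^{1/2}(X^{1/2}YX^{1/2})^{-1/2}X^{1/2}$, $D=P^{1/2}$, $V=\frac1{\sqrt\mu}D^{-1}XD^{-1}=\frac1{\sqrt\mu}DYD$, and $\Psi(X,Y,\mu)=\Psi(V)$. Search direction: with $\tilde L(Z)=D\,L(DZD)\,D$, let $(D_X,D_Y)$ be the unique symmetric solution of $D_X+D_Y=-\psi'(V)$, $\tilde L(D_X)=D_Y$, and set $\Delta X=\sqrt\mu\,D D_X D$, $\Delta Y=\sqrt\mu\,D^{-1}D_YD^{-1}$. Default step size: $\tilde\alpha=\frac1{\psi''(\rho(2\delta))}$, where $\delta=\delta(V)$ and $\rho:[0,\infty)\to(0,1]$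 is the inverse function of the restriction of $-\frac12\psi'$ to $(0,1]$. Algorithm: start with $X=X^0$, $Y=Y^0$, $\mu=\mu^0$. While $n\mu\ge\epsilon$ (outer loop): replace $\mu$ by $(1-\theta)\mu$; then, while $\Psi(X,Y,\mu)>\tau$ (inner loop): compute $\Delta X=\sqrt\mu\,D D_X D$ and $\Delta Y=\sqrt\mu\,D^{-1}D_YD^{-1}$, where $D=P^{1/2}$ with $P=X^{1/2}(X^{1/2}YX^{1/2})^{-1/2}X^{1/2}$, $V=\frac1{\sqrt\mu}D^{-1}XD^{-1}$, and $(D_X,D_Y)$ is the unique symmetric solution of $D_X+D_Y=-\psi'(V)$, $D\,L(DD_XD)\,D=D_Y$, for the current $(X,Y,\mu)$ and replace $(X,Y)$ by $(X,Y)+\tilde\alpha(\Delta X,\Delta Y)$. Each pass through the inner loop is one iteration; the total number of iterations is the total number of inner iterations over all outer iterations.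
   Formalization: The factor (1/θ)log(nμ⁰/ε) is replaced by max(1,(1/θ)log(nμ⁰/ε)), since the printed bound fails when this quantity is small: for ε=nμ⁰ it is 0 although inner iterations can occur, and for ε>nμ⁰ it is negative. *)

(* Defs.v *)
From HB Require Import structures.
From mathcomp Require Import all_boot all_order all_algebra.
From mathcomp Require Import all_classical all_reals all_analysis.
Import Order.TTheory GRing.Theory Num.Theory.
Import numFieldNormedType.Exports.

Set Implicit Arguments.
Unset Strict Implicit.
Unset Printing Implicit Defensive.

Local Open Scope classical_set_scope.
Local Open Scope ring_scope.

(* Real symmetric n x n matrices are the M : 'M[R]_n with M \is symmetricmx. *)

Section MatrixFunctions.
Variables (R : realType) (n : nat).
Implicit Types A X Y : 'M[R]_n.

Definition posdefmx A : Prop :=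
  A \is symmetricmx /\
  forall u : 'cV[R]_n, u != 0 -> 0 < (u^T *m A *m u) ord0 ord0.

(* A pair (U, d) with U orthogonal and A = U diag(d) U^T; the default value
   (1, 0) is only reached when A is not symmetric. *)
Definition eigendecomposition A : 'M[R]_n * 'rV[R]_n :=
  xget (1%:M, 0) [set Ud : 'M[R]_n * 'rV[R]_n |
    Ud.1 *m Ud.1^T = 1%:M /\ A = Ud.1 *m diag_mx Ud.2 *m Ud.1^T].

(* f applied to the eigenvalues of the symmetric matrix A; the result does not
   depend on the eigendecomposition. *)
Definition mxfun (f : R -> R) A : 'M[R]_n :=
  let Ud := eigendecomposition A in
  Ud.1 *m diag_mx (map_mx f Ud.2) *m Ud.1^T.

Definition mxsqrt A : 'M[R]_n := mxfun Num.sqrt A.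

Definition frobenius_norm A : R := Num.sqrt (\tr (A *m A^T)).

Definition monotone_mx (L : 'M[R]_n -> 'M[R]_n) : Prop :=
  forall Z, Z \is symmetricmx -> 0 <= \tr (Z *m L Z).

Definition strictly_feasible (L : 'M[R]_n -> 'M[R]_n) (Q X Y : 'M[R]_n) : Prop :=
  [/\ posdefmx X, posdefmx Y & Y = L X + Q].

End MatrixFunctions.

Section Kernel.
Variable R : realType.

Definition psi (t : R) : R :=
  2^-1 * (2 * t ^+ 2 + (t ^+ 2)^-1 - 5) + expR (t^-1 - 1).

(* Inverse of the restriction of - psi' / 2 to the interval ]0, 1]. *)
Definition rho : R -> R :=
  'pinv_(fun=> 1) [set t : R | 0 < t <= 1] (fun t => - 2^-1 * derive1 psi t).

End Kernel.

Section Algorithm.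
Variables (R : realType) (n : nat).
Implicit Types (L : 'M[R]_n -> 'M[R]_n) (X Y V : 'M[R]_n) (mu theta tau eps : R).

Definition Psi V : R := \tr (mxfun (@psi R) V).

Definition delta V : R := 2^-1 * frobenius_norm (mxfun (derive1 (@psi R)) V).

Definition scalingP X Y : 'M[R]_n :=
  let X12 := mxsqrt X in
  X12 *m invmx (mxsqrt (X12 *m Y *m X12)) *m X12.

Definition scalingD X Y : 'M[R]_n := mxsqrt (scalingP X Y).

Definition scaledV X Y mu : 'M[R]_n :=
  (Num.sqrt mu)^-1 *: (invmx (scalingD X Y) *m X *m invmx (scalingD X Y)).

Definition proximity X Y mu : R := Psi (scaledV X Y mu).

(* The pair (D_X, D_Y); for a monotone L and positive definite X, Y the
   defining system has exactly one symmetric solution. *)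
Definition scaled_direction L X Y mu : 'M[R]_n * 'M[R]_n :=
  let D := scalingD X Y in
  xget (0, 0) [set d : 'M[R]_n * 'M[R]_n |
    [/\ d.1 \is symmetricmx, d.2 \is symmetricmx,
        d.1 + d.2 = - mxfun (derive1 (@psi R)) (scaledV X Y mu)
      & D *m L (D *m d.1 *m D) *m D = d.2]].

Definition default_step V : R := (derive1n 2 (@psi R) (rho (2 * delta V)))^-1.

Definition inner_step L mu X Y : 'M[R]_n * 'M[R]_n :=
  let D := scalingD X Y in
  let d := scaled_direction L X Y mu in
  let alpha := default_step (scaledV X Y mu) in
  (X + alpha *: (Num.sqrt mu *: (D *m d.1 *m D)),
   Y + alpha *: (Num.sqrt mu *: (invmx D *m d.2 *m invmx D))).

(* inner_loop L tau mu XY XY' k: started at XY, the inner loop for the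
   parameter mu stops at XY' after exactly k iterations. *)
Inductive inner_loop L tau mu :
    'M[R]_n * 'M[R]_n -> 'M[R]_n * 'M[R]_n -> nat -> Prop :=
  | inner_stop X Y : proximity X Y mu <= tau ->
      inner_loop L tau mu (X, Y) (X, Y) 0
  | inner_iter X Y XY' k : tau < proximity X Y mu ->
      inner_loop L tau mu (inner_step L mu X Y) XY' k ->
      inner_loop L tau mu (X, Y) XY' k.+1.

(* ipm_run L tau theta eps mu XY N: started at XY with parameter mu, the
   algorithm terminates, after exactly N inner iterations in total. *)
Inductive ipm_run L tau theta eps :
    R -> 'M[R]_n * 'M[R]_n -> nat -> Prop :=
  | run_stop mu XY : n%:R * mu < eps -> ipm_run L tau theta eps mu XY 0
  | run_outer mu XY XY' k N : eps <= n%:R * mu ->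
      inner_loop L tau ((1 - theta) * mu) XY XY' k ->
      ipm_run L tau theta eps ((1 - theta) * mu) XY' N ->
      ipm_run L tau theta eps mu XY (k + N).

End Algorithm.

(* Main.v *)
Require Import Defs.
From HB Require Import structures.
From mathcomp Require Import all_boot all_order all_algebra.
From mathcomp Require Import all_classical all_reals all_analysis.
From mathcomp Require Import ring lra complex.
Import Order.TTheory GRing.Theory Num.Theory.
Import numFieldNormedType.Exports.
Set Implicit Arguments.
Unset Strict Implicit.
Unset Printing Implicit Defensive.
Local Open Scope ring_scope.

(* An inner step moves X and Y to the scaled matrices V + alpha D_X and V + alpha D_Y,
   which are congruent, by a matrix and by its inverse transposed, to the scaled matrix V'
   of the new pair; hence Psi V' is at most the mean of Psi (V + alpha D_X) and
   Psi (V + alpha D_Y).  The eigenvalues of both stay above t := rho (2 delta), where psi''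
   is at most psi'' t, so for alpha = 1 / psi'' t a second-order bound gives a decrease of
   at least delta ^ 2 / psi'' t, which is at least a constant times sqrt Psi / log ^ 2.  So
   sqrt Psi drops by at least a fixed amount, and each outer iteration, which starts with
   Psi <= Psi0, has at most a multiple of log ^ 2 * sqrt Psi0 inner iterations. *)

(** The matrices involved do not commute, so no matrix function is ever differentiated: two
    eigenbases are compared through the squared inner products of their vectors, and scalar
    inequalities are summed with these weights. The step size has this origin. The eigenvalues of
    [V] satisfy [psi' >= - 2 delta], whereas [psi' = - 4 delta] at [rho (2 delta)]. The gap puts
    every eigenvalue at least [2 delta / psi''] above [rho (2 delta)], which is just what a
    perturbation by [alpha D_X] or [alpha D_Y] can consume: monotonicity of [L] gives
    [tr (D_X D_Y) >= 0], so both directions have Frobenius norm at most [2 delta]. The squared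
    logarithm comes from the equation defining [t = rho (2 delta)]: it bounds [expR (t^-1 - 1)] by
    [4 delta + 1], so [t^-1] is at most logarithmic in [delta], and [psi'' t] is of order
    [delta * t^-1 ^ 2]. *)

Lemma symmetricmxP (F : fieldType) n (A : 'M[F]_n) :
  reflect (A^T = A) (A \is symmetricmx).
Proof.
by rewrite is_hermitianmxE expr0 scale1r map_mx_id // eq_sym; apply: eqP.
Qed.

(** * The spectral theorem for real symmetric matrices *)

Section SpectralTheorem.
Variable R : rcfType.

(** Over the complex numbers [A] becomes Hermitian, so its eigenvalues are real; a real number that
    is an eigenvalue over the extension is already one over [R]. *)
Lemma symmetricmx_eigenvector n (A : 'M[R]_n.+1) : A \is symmetricmx ->
  exists l, exists2 v : 'cV[R]_n.+1, v != 0 & A *m v = l *: v.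
Proof.
move=> /symmetricmxP Asym.
pose toC := real_complex R; pose AC := map_mx toC A.
have AC_herm : AC \is hermsymmx.
  apply: realsym_hermsym.
    by apply/symmetricmxP; rewrite map_trmx Asym.
  by apply/mxOverP => i j; rewrite mxE /toC complex_real.
pose P := spectralmx AC; pose d := spectral_diag AC.
have ACE : AC = invmx P *m diag_mx d *m P :=
  orthomx_spectralP (hermitian_normalmx AC_herm).
have /mxOverP/(_ 0 0)/complex_realP[l dE] := hermitian_spectral_diag_real AC_herm.
have Punit : P \in unitmx := spectral_unit AC.
have : eigenvalue AC (toC l).
  apply/eigenvalueP; exists (row 0 P); last first.
    apply: contraTneq Punit => P0; rewrite unitmxE (expand_det_row P 0).
    by rewrite big1 ?unitr0 // => j _; move/rowP/(_ j): P0; rewrite !mxE => ->; rewrite mul0r.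
  rewrite -row_mul ACE !mulmxA mulmxV // mul1mx.
  by apply/rowP => j; rewrite mul_diag_mx !mxE dE.
rewrite eigenvalue_map => /eigenvalueP[v vA v0].
(* [eigenvalue] speaks of row vectors; symmetry of [A] turns [v] into a column eigenvector. *)
exists l; exists v^T; first by rewrite -trmx0 (inj_eq trmx_inj).
by rewrite -{1}Asym -trmx_mul vA linearZ.
Qed.

Lemma mulmx_tr_cV_gt0 n (v : 'cV[R]_n) : v != 0 -> 0 < (v^T *m v) 0 0.
Proof.
move=> v0; rewrite mxE lt0r sumr_ge0 => [|i _]; last by rewrite mxE -expr2 sqr_ge0.
rewrite andbT; apply: contraNneq v0 => /eqP.
rewrite psumr_eq0 => [/allP h|i _]; last by rewrite mxE -expr2 sqr_ge0.
apply/eqP/colP => i; have := h i (mem_index_enum i).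
by rewrite !mxE mulf_eq0 orbb => /eqP.
Qed.

(* Householder reflection in the hyperplane orthogonal to v - e_0. *)
Lemma orthogonal_first_column n (v : 'cV[R]_n.+1) : v^T *m v = 1%:M ->
  exists2 H : 'M[R]_n.+1, H *m H^T = 1%:M & H *m delta_mx 0 0 = v.
Proof.
move=> v1; set e : 'cV[R]_n.+1 := delta_mx 0 0.
have e1 : e^T *m e = 1%:M by rewrite trmx_delta mul_delta_mx [LHS]mx11_scalar mxE !eqxx.
have [->|ve] := eqVneq v e; first by exists 1%:M; rewrite ?trmx1 ?mul1mx.
pose w := v - e; pose c := (v^T *m e) 0 0.
have veE : v^T *m e = c%:M by rewrite [LHS]mx11_scalar.
have evE : e^T *m v = c%:M by rewrite -[RHS]tr_scalar_mx -veE trmx_mul trmxK.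
have wwE : w^T *m w = (2 - 2 * c)%:M.
  rewrite [w^T]linearB /= mulmxBl !mulmxBr v1 e1 veE evE -!raddfB /=.
  by congr (_%:M); ring.
(* [2 - 2 * c] is the squared norm of [w], and [k] below is the factor 2 / |w|^2 of the
   reflection. *)
have c1 : 2 - 2 * c != 0.
  have := @mulmx_tr_cV_gt0 _ w; rewrite wwE subr_eq0 => /(_ ve).
  by rewrite !mxE mulr1n => /lt0r_neq0.
pose k := 2 / (2 - 2 * c).
have kE : k * (2 - 2 * c) = 2 by rewrite /k -mulrA mulVf ?mulr1.
pose H := 1%:M - k *: (w *m w^T).
have HT : H^T = H by rewrite /H linearB linearZ /= trmx1 trmx_mul trmxK.
exists H.
  rewrite HT; pose W := w *m w^T.
  have WW : W *m W = (2 - 2 * c) *: W.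
    by rewrite /W mulmxA -[w *m w^T *m w]mulmxA wwE mul_mx_scalar scalemxAl.
  rewrite /H -/W mulmxBl !mulmxBr !mul1mx mulmx1 -scalemxAl -scalemxAr WW.
  rewrite !scalerA -[k * k * _]mulrA kE.
  by apply/matrixP => i j; rewrite !mxE; ring.
have weE : w^T *m e = (c - 1)%:M.
  by rewrite [w^T]linearB /= mulmxBl veE e1 -raddfB.
rewrite /H mulmxBl mul1mx -scalemxAl -mulmxA weE mul_mx_scalar scalerA.
have -> : k * (c - 1) = -1 by lra.
by rewrite scaleN1r opprK addrC subrK.
Qed.

(** Deflation: an orthogonal [H] taking e_0 to a unit eigenvector makes the first column of
    [H^T A H] a multiple of e_0, and by symmetry the first row too; the induction hypothesis handles
    the remaining block. *)
Lemma symmetricmx_diagonalization n (A : 'M[R]_n) : A \is symmetricmx ->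
  exists U : 'M[R]_n, exists2 d : 'rV[R]_n,
    U *m U^T = 1%:M & A = U *m diag_mx d *m U^T.
Proof.
elim: n A => [|n IHn] A Asym; first by exists 1%:M, 0; apply/matrixP => -[].
have [l [v v0 Av]] := symmetricmx_eigenvector Asym.
pose c := (v^T *m v) 0 0; have c0 : 0 < c := mulmx_tr_cV_gt0 v0.
pose v1 := (Num.sqrt c)^-1 *: v.
have v1E : v1^T *m v1 = 1%:M.
  rewrite /v1 [_^T]linearZ /= -scalemxAl -scalemxAr scalerA [v^T *m v]mx11_scalar -/c.
  by rewrite -invfM -expr2 sqr_sqrtr ?ltW // scale_scalar_mx mulVf ?lt0r_neq0.
have Av1 : A *m v1 = l *: v1 by rewrite /v1 -scalemxAr Av !scalerA mulrC.
have [H HH He] := orthogonal_first_column v1E.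
have HtH : H^T *m H = 1%:M by apply: mulmx1C.
have [B BHA] : exists B, B = H^T *m A *m H by eexists.
have BT : B^T = B.
  by rewrite BHA !trmx_mul trmxK (symmetricmxP _ Asym) mulmxA.
have Be : B *m delta_mx 0 0 = l *: (delta_mx 0 0 : 'cV[R]_n.+1).
  by rewrite BHA -mulmxA He -mulmxA Av1 -scalemxAr -He mulmxA HtH mul1mx.
have B0 i : B i 0 = l * (i == 0)%:R.
  move/colP/(_ i): Be; rewrite !mxE (bigD1 0) //= big1 => [|j /negPf j0].
    by rewrite [_ 0 0]mxE !eqxx mulr1 addr0 andbT.
  by rewrite [_ j 0]mxE j0 mulr0.
pose B' : 'M[R]_n := @drsubmx R 1 n 1 n B.
have BE : B = block_mx (l%:M : 'M[R]_1) 0 0 B'.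
  rewrite -[LHS](@submxK R 1 n 1 n).
  have -> : @ulsubmx R 1 n 1 n B = l%:M.
    apply/matrixP => i j; rewrite !ord1 !mxE [lshift _ _](_ : _ = 0) ?B0.
      by rewrite eqxx mulr1.
    exact: val_inj.
  have -> : @ursubmx R 1 n 1 n B = 0.
    apply/matrixP => i j; rewrite !ord1 !mxE [lshift _ _](_ : _ = 0).
      by rewrite -BT mxE B0 mulr0.
    exact: val_inj.
  have -> : @dlsubmx R 1 n 1 n B = 0.
    apply/matrixP => i j; rewrite !ord1 !mxE [lshift _ _](_ : _ = 0).
      by rewrite B0 mulr0.
    exact: val_inj.
  by [].
have [|U [d UU dE]] := IHn B'.
  by apply/symmetricmxP; rewrite trmx_drsub BT.
pose K : 'M[R]_(1 + n) := block_mx 1%:M 0 0 U.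
have KK : K *m K^T = 1%:M.
  rewrite /K tr_block_mx mulmx_block !trmx0 !mulmx0 !mul0mx trmx1 mulmx1.
  by rewrite UU !addr0 add0r -scalar_mx_block.
exists (H *m K), (row_mx l%:M d : 'rV[R]_(1 + n)).
  by rewrite trmx_mul mulmxA -[H *m K *m _]mulmxA KK mulmx1.
have -> : A = H *m B *m H^T.
  by rewrite BHA !mulmxA HH mul1mx -mulmxA HH mulmx1.
suff -> : B = K *m diag_mx (row_mx l%:M d : 'rV[R]_(1 + n)) *m K^T.
  by rewrite trmx_mul !mulmxA.
rewrite BE diag_mx_row {1}dE /K tr_block_mx !mulmx_block.
rewrite !trmx0 !mulmx0 !mul0mx !addr0 !add0r trmx1 mulmx1 mul1mx !mul0mx.
suff -> : diag_mx l%:M = l%:M :> 'M[R]_1 by [].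
by apply/matrixP => i j; rewrite !ord1 !mxE eqxx.
Qed.

End SpectralTheorem.

(** * Matrix functions, positive definite matrices and trace inequalities *)

Section MatrixCalculus.
Variables (R : realType) (n : nat).
Implicit Types (A B U W M : 'M[R]_n) (d a b w : 'rV[R]_n) (f g : R -> R).

Definition is_spectral A U d := U *m U^T = 1%:M /\ A = U *m diag_mx d *m U^T.

Lemma is_spectral_sym A U d : is_spectral A U d -> A \is symmetricmx.
Proof.
by case=> _ ->; apply/symmetricmxP; rewrite !trmx_mul trmxK tr_diag_mx mulmxA.
Qed.

Lemma is_spectral_trV A U d : is_spectral A U d -> U^T *m U = 1%:M.
Proof. by case=> /mulmx1C. Qed.

Lemma eigendecompositionP A : A \is symmetricmx ->
  is_spectral A (eigendecomposition A).1 (eigendecomposition A).2.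
Proof.
move=> /symmetricmx_diagonalization[U [d UU AE]].
rewrite /eigendecomposition; case: xgetP => [Ud _ //|/(_ (U, d))].
by case; split.
Qed.

(** Two eigenbases are related by [S = U0^T U], which intertwines the two diagonals: a nonzero
    [S i j] forces the eigenvalues [d0 i] and [d j] to agree, hence also their images under [f]. *)
Lemma mxfunE f A U d : is_spectral A U d ->
  mxfun f A = U *m diag_mx (map_mx f d) *m U^T.
Proof.
move=> sA; have [UU AE] := sA; have UtU := is_spectral_trV sA.
have s0 := eigendecompositionP (is_spectral_sym sA).
rewrite /mxfun; case: (eigendecomposition A) s0 => /= U0 d0 s0.
have [UU0 AE0] := s0; have UtU0 := is_spectral_trV s0.
pose S := U0^T *m U.
have dS : diag_mx d0 *m S = S *m diag_mx d.
  have : U0^T *m A *m U = U0^T *m A *m U by [].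
  rewrite {1}AE0 {1}AE /S !mulmxA UtU0 mul1mx => ->.
  by rewrite -!mulmxA UtU mulmx1 !mulmxA.
have fS : diag_mx (map_mx f d0) *m S = S *m diag_mx (map_mx f d).
  move/matrixP: dS => dS; apply/matrixP => i j; have := dS i j.
  rewrite mul_diag_mx mul_mx_diag mul_diag_mx mul_mx_diag 4!mxE.
  rewrite [map_mx f d0 0 i]mxE [map_mx f d 0 j]mxE.
  have [->|S0] := eqVneq (S i j) 0; first by rewrite !mulr0 !mul0r.
  by rewrite mulrC => /(mulfI S0) ->; rewrite mulrC.
have -> : U0 *m diag_mx (map_mx f d0) *m U0^T
    = U0 *m (diag_mx (map_mx f d0) *m S) *m U^T.
  by rewrite /S -!mulmxA UU mulmx1.
by rewrite fS /S !mulmxA UU0 mul1mx.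
Qed.

Lemma is_spectral_mxfun f A U d : is_spectral A U d ->
  is_spectral (mxfun f A) U (map_mx f d).
Proof. by move=> sA; split; [case: sA | exact: mxfunE]. Qed.

Lemma mxtrace_spectral A U d : is_spectral A U d -> \tr A = \sum_i d 0 i.
Proof.
move=> sA; have UtU := is_spectral_trV sA; case: sA => _ ->.
by rewrite mxtrace_mulC mulmxA UtU mul1mx mxtrace_diag.
Qed.

Lemma is_spectral_mul A B U a b : is_spectral A U a -> is_spectral B U b ->
  is_spectral (A *m B) U (\row_i (a 0 i * b 0 i)).
Proof.
move=> sA sB; have UtU := is_spectral_trV sA.
case: sA sB => UU -> [_ ->]; split => //.
rewrite -mulmx_diag -!mulmxA; congr (U *m (_ *m _)).
by rewrite !mulmxA UtU mul1mx.
Qed.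

Lemma is_spectralZ c A U a : is_spectral A U a ->
  is_spectral (c *: A) U (c *: a).
Proof.
by case=> UU ->; split => //; rewrite linearZ /= -scalemxAr -scalemxAl.
Qed.

Lemma is_spectral_invmx A U a : is_spectral A U a ->
  (forall i, a 0 i != 0) -> A \in unitmx /\ is_spectral (invmx A) U (map_mx GRing.inv a).
Proof.
move=> sA a0; have sI := is_spectral_mxfun GRing.inv sA.
have AA : A *m mxfun GRing.inv A = 1%:M.
  have sM := is_spectral_mul sA sI; have [UU ->] := sM.
  suff -> : diag_mx (\row_i (a 0 i * map_mx GRing.inv a 0 i)) = 1%:M.
    by rewrite mulmx1.
  by apply/matrixP => i j; rewrite !mxE mulfV.
have Au := (mulmx1_unit AA).1; split => //.
suff -> : invmx A = mxfun GRing.inv A by [].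
by rewrite -[RHS](mulKmx Au) AA mulmx1.
Qed.

Lemma quadratic_spectral A U d (u : 'cV[R]_n) : is_spectral A U d ->
  (u^T *m A *m u) 0 0 = \sum_i d 0 i * (U^T *m u) i 0 ^+ 2.
Proof.
case=> _ ->; have -> : u^T *m (U *m diag_mx d *m U^T) *m u
   = (U^T *m u)^T *m (diag_mx d *m (U^T *m u)).
  by rewrite trmx_mul trmxK !mulmxA.
rewrite mxE; apply: eq_bigr => i _; rewrite mul_diag_mx [_^T _ _]mxE.
by rewrite [X in _ * X]mxE mulrCA -expr2.
Qed.

Lemma posdefmx_spectral A U d : is_spectral A U d ->
  posdefmx A <-> forall i, 0 < d 0 i.
Proof.
move=> sA; have UtU := is_spectral_trV sA; split=> [[_ Apos] i|dpos].
  have := Apos (U *m delta_mx i 0); rewrite (quadratic_spectral _ sA).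
  rewrite mulmxA UtU mul1mx (bigD1 i) //= mxE !eqxx expr1n mulr1 big1 ?addr0.
    apply; apply: contraTneq isT => U0.
    have := congr1 (mulmx U^T) U0; rewrite mulmxA UtU mul1mx mulmx0.
    by move/colP/(_ i)/eqP; rewrite !mxE !eqxx oner_eq0.
  by move=> j /negPf ji; rewrite mxE ji expr0n mulr0.
split=> [|u u0]; first exact: is_spectral_sym sA.
rewrite (quadratic_spectral _ sA).
have v0 : U^T *m u != 0.
  apply: contra_neq u0 => U0.
  by rewrite -[u]mul1mx -(proj1 sA) -mulmxA U0 mulmx0.
have ge0 i : 0 <= d 0 i * (U^T *m u) i 0 ^+ 2.
  by rewrite mulr_ge0 ?sqr_ge0 // ltW.
rewrite lt0r sumr_ge0 // andbT; apply: contra v0; rewrite psumr_eq0 // => /allP h.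
apply/eqP/colP => i; have := h i (mem_index_enum i).
by rewrite /= mulf_eq0 (gt_eqF (dpos i)) /= sqrf_eq0 => /eqP ->; rewrite mxE.
Qed.

Lemma posdefmxP A : posdefmx A ->
  exists U, exists2 d, is_spectral A U d & forall i, 0 < d 0 i.
Proof.
move=> Apos; have [Asym _] := Apos; have sA := eigendecompositionP Asym.
by do 2!eexists; first exact: sA; apply/(posdefmx_spectral sA).
Qed.

Lemma posdefmx_unit A : posdefmx A -> A \in unitmx.
Proof.
move=> /posdefmxP[U [d sA dpos]].
by have [] // := is_spectral_invmx sA; move=> i; rewrite gt_eqF.
Qed.

Lemma posdefmx_inv A : posdefmx A -> posdefmx (invmx A).
Proof.
move=> /posdefmxP[U [d sA dpos]].
have [|_ sI] := is_spectral_invmx sA; first by move=> i; rewrite gt_eqF.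
by apply/(posdefmx_spectral sI) => i; rewrite mxE invr_gt0.
Qed.

Lemma posdefmx_sqrt A : posdefmx A -> posdefmx (mxsqrt A).
Proof.
move=> /posdefmxP[U [d sA dpos]].
apply/(posdefmx_spectral (is_spectral_mxfun Num.sqrt sA)) => i.
by rewrite mxE sqrtr_gt0.
Qed.

Lemma mulmx_sqrt A : posdefmx A -> mxsqrt A *m mxsqrt A = A.
Proof.
move=> /posdefmxP[U [d sA dpos]]; have sS := is_spectral_mxfun Num.sqrt sA.
have [_ ->] := is_spectral_mul sS sS; have [_ AE] := sA; rewrite [RHS]AE.
congr (_ *m diag_mx _ *m _); apply/rowP => i.
by rewrite !mxE -expr2 sqr_sqrtr // ltW.
Qed.

Lemma posdefmx_congr A M : posdefmx A -> M \in unitmx ->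
  posdefmx (M^T *m A *m M).
Proof.
move=> [Asym Apos] Mu; split.
  by apply/symmetricmxP; rewrite !trmx_mul trmxK (symmetricmxP _ Asym) mulmxA.
move=> u u0; have := Apos (M *m u).
rewrite trmx_mul !mulmxA; apply.
by apply: contra_neq u0 => M0; rewrite -[u](mulKmx Mu) M0 mulmx0.
Qed.

Lemma posdefmx_tr A : posdefmx A -> A^T = A.
Proof. by case=> /symmetricmxP. Qed.

Lemma posdefmx_congr_sym A M : posdefmx A -> posdefmx M ->
  posdefmx (M *m A *m M).
Proof.
move=> Apos Mpos; rewrite -{1}(posdefmx_tr Mpos).
exact: posdefmx_congr (posdefmx_unit Mpos).
Qed.

Lemma posdefmxZ c A : 0 < c -> posdefmx A -> posdefmx (c *: A).
Proof.
move=> c0 /posdefmxP[U [d sA dpos]].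
by apply/(posdefmx_spectral (is_spectralZ c sA)) => i; rewrite mxE mulr_gt0.
Qed.

Lemma mxtrace_mul_spectral A B U W a b : is_spectral A U a -> is_spectral B W b ->
  \tr (A *m B) = \sum_i \sum_j a 0 i * b 0 j * (U^T *m W) i j ^+ 2.
Proof.
move=> [_ ->] [_ ->]; set S := U^T *m W.
have -> : \tr (U *m diag_mx a *m U^T *m (W *m diag_mx b *m W^T))
    = \tr (diag_mx a *m S *m diag_mx b *m S^T).
  by rewrite -!mulmxA mxtrace_mulC /S trmx_mul trmxK !mulmxA.
apply: eq_bigr => i _; rewrite mxE; apply: eq_bigr => j _.
rewrite mul_mx_diag mul_diag_mx 2!mxE [S^T _ _]mxE expr2; ring.
Qed.

(** The squared entries of the orthogonal matrix [U^T W] form a doubly stochastic matrix; this lemma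
    uses its row sums, the next one its column sums. *)
Lemma sum_spectral_weights U W (h : 'I_n -> R) : U *m U^T = 1%:M -> W *m W^T = 1%:M ->
  \sum_i \sum_j h i * (U^T *m W) i j ^+ 2 = \sum_i h i.
Proof.
move=> /mulmx1C UU WW; apply: eq_bigr => i _; rewrite -mulr_sumr.
suff -> : \sum_j (U^T *m W) i j ^+ 2 = 1 by rewrite mulr1.
have : (U^T *m W *m (U^T *m W)^T) i i = 1.
  by rewrite trmx_mul trmxK mulmxA -[_ *m W *m _]mulmxA WW mulmx1 UU mxE eqxx.
by rewrite mxE => <-; apply: eq_bigr => j _; rewrite [_^T _ _]mxE expr2.
Qed.

Lemma sum_spectral_weightsC U W (h : 'I_n -> R) : U *m U^T = 1%:M -> W *m W^T = 1%:M ->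
  \sum_i \sum_j h j * (U^T *m W) i j ^+ 2 = \sum_j h j.
Proof.
move=> UU WW; rewrite exchange_big /= -(sum_spectral_weights h WW UU).
apply: eq_bigr => j _; apply: eq_bigr => i _; congr (_ * _ ^+ 2).
(* The weight is read as an entry of the transpose of [W^T *m U]. *)
by rewrite -[RHS](mxE trmx_key (fun i j => (W^T *m U) j i)) -/(trmx _) trmx_mul trmxK.
Qed.

(* Klein's inequality: an inequality between the eigenvalues passes to traces, since
   every trace below is a sum over (i, j) with the weights <u_i, w_j> ^ 2. *)
Lemma trace_second_order_bound f g c A B U W a b :
  is_spectral A U a -> is_spectral B W b ->
  (forall i j, f (b 0 j) <= f (a 0 i) + g (a 0 i) * (b 0 j - a 0 i)
                            + c * (b 0 j - a 0 i) ^+ 2) ->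
  \tr (mxfun f B) <= \tr (mxfun f A) + \tr (mxfun g A *m (B - A))
                     + c * \tr ((B - A) *m (B - A)).
Proof.
move=> sA sB h; have [UU _] := sA; have [WW _] := sB.
have sgA := is_spectral_mxfun g sA.
pose E (F : 'I_n -> 'I_n -> R) := \sum_i \sum_j F i j * (U^T *m W) i j ^+ 2.
have ED F G : E F + E G = E (fun i j => F i j + G i j).
  rewrite /E -big_split; apply: eq_bigr => i _; rewrite -big_split.
  by apply: eq_bigr => j _; rewrite mulrDl.
have EZ k F : k * E F = E (fun i j => k * F i j).
  rewrite /E mulr_sumr; apply: eq_bigr => i _; rewrite mulr_sumr.
  by apply: eq_bigr => j _; rewrite mulrA.
have El (h' : 'I_n -> R) : \sum_i h' i = E (fun i _ => h' i).
  by rewrite -(sum_spectral_weights h' UU WW).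
have Er (h' : 'I_n -> R) : \sum_j h' j = E (fun _ j => h' j).
  by rewrite -(sum_spectral_weightsC h' UU WW).
have -> : \tr (mxfun f B) = E (fun _ j => f (b 0 j)).
  rewrite (mxtrace_spectral (is_spectral_mxfun f sB)) -Er.
  by apply: eq_bigr => i _; rewrite mxE.
have -> : \tr (mxfun f A) = E (fun i _ => f (a 0 i)).
  rewrite (mxtrace_spectral (is_spectral_mxfun f sA)) -El.
  by apply: eq_bigr => i _; rewrite mxE.
have -> : \tr (mxfun g A *m (B - A)) =
    E (fun i j => g (a 0 i) * b 0 j) + -1 * E (fun i _ => g (a 0 i) * a 0 i).
  rewrite mulmxBr raddfB /= (mxtrace_mul_spectral sgA sB) mulN1r; congr (_ - _).
    by apply: eq_bigr => i _; apply: eq_bigr => j _; rewrite mxE.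
  rewrite (mxtrace_spectral (is_spectral_mul sgA sA)) -El.
  by apply: eq_bigr => i _; rewrite !mxE.
have -> : \tr ((B - A) *m (B - A)) = E (fun _ j => b 0 j * b 0 j) +
    -2 * E (fun i j => a 0 i * b 0 j) + E (fun i _ => a 0 i * a 0 i).
  have -> : \tr ((B - A) *m (B - A)) = \tr (B *m B) + - 2 * \tr (A *m B) + \tr (A *m A).
    rewrite mulmxBl !mulmxBr !raddfB /= [\tr (B *m A)]mxtrace_mulC; ring.
  rewrite (mxtrace_mul_spectral sA sB) -El -Er.
  rewrite (mxtrace_spectral (is_spectral_mul sA sA)).
  rewrite (mxtrace_spectral (is_spectral_mul sB sB)).
  by congr (_ + _ + _); apply: eq_bigr => i _; rewrite !mxE.
rewrite !(ED, EZ); apply: ler_sum => i _; apply: ler_sum => j _.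
apply: ler_wpM2r; first exact: sqr_ge0.
by apply: le_trans (h i j) _; rewrite le_eqVlt; apply/orP; left; apply/eqP; ring.
Qed.

End MatrixCalculus.

(** * Perturbation of eigenvalues, and traces under congruence *)

Section ScaledMatrices.
Variables (R : realType) (n : nat).
Implicit Types (A B U W M N X Y V : 'M[R]_n) (d a b w : 'rV[R]_n) (f g : R -> R).

Lemma frobenius_norm_sym A U d : is_spectral A U d ->
  frobenius_norm A = Num.sqrt (\sum_i d 0 i ^+ 2).
Proof.
move=> sA; rewrite /frobenius_norm (symmetricmxP _ (is_spectral_sym sA)).
rewrite (mxtrace_spectral (is_spectral_mul sA sA)); congr Num.sqrt.
by apply: eq_bigr => i _; rewrite mxE.
Qed.

Lemma norm_eigenvalue_le A U d i : is_spectral A U d ->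
  `|d 0 i| <= frobenius_norm A.
Proof.
move=> sA; rewrite (frobenius_norm_sym sA) -sqrtr_sqr ler_wsqrtr //.
by rewrite (bigD1 i) //= lerDl sumr_ge0 // => j _; exact: sqr_ge0.
Qed.

Lemma sum_sqr_orthogonal U (u : 'cV[R]_n) : U *m U^T = 1%:M ->
  \sum_i (U^T *m u) i 0 ^+ 2 = \sum_i u i 0 ^+ 2.
Proof.
move=> UU; have E (v : 'cV[R]_n) : \sum_i v i 0 ^+ 2 = (v^T *m v) 0 0.
  by rewrite mxE; apply: eq_bigr => i _; rewrite [_^T _ _]mxE expr2.
by rewrite !E trmx_mul trmxK mulmxA -[_ *m U *m _]mulmxA UU mulmx1.
Qed.

(** Evaluate the quadratic form of [A + B] at its unit eigenvector [W e_j]: the part from [A] is at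
    least [m], and the part from [B] is at least minus its Frobenius norm, which dominates every
    eigenvalue of [B]. *)
Lemma eigenvalue_perturbation A B U W a b m : is_spectral A U a ->
  is_spectral (A + B) W b -> (forall i, m <= a 0 i) ->
  forall j, m - frobenius_norm B <= b 0 j.
Proof.
move=> sA sAB am j.
have Bsym : B \is symmetricmx.
  have /symmetricmxP := is_spectral_sym sAB; have /symmetricmxP := is_spectral_sym sA.
  by rewrite linearD /= => -> /addrI /symmetricmxP.
have sB := eigendecompositionP Bsym.
set O := (_ B).1 in sB; set e := (_ B).2 in sB.
pose v : 'cV[R]_n := W *m delta_mx j 0.
have v1 : \sum_i v i 0 ^+ 2 = 1.
  rewrite -(sum_sqr_orthogonal v (proj1 sAB)) /v mulmxA (is_spectral_trV sAB).
  rewrite mul1mx (bigD1 j) //= mxE !eqxx expr1n big1 ?addr0 // => i /negPf ij.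
  by rewrite mxE ij expr0n.
have <- : (v^T *m (A + B) *m v) 0 0 = b 0 j.
  rewrite (quadratic_spectral _ sAB) /v mulmxA (is_spectral_trV sAB) mul1mx.
  rewrite (bigD1 j) //= mxE !eqxx expr1n mulr1 big1 ?addr0 // => i /negPf ij.
  by rewrite mxE ij expr0n mulr0.
rewrite mulmxDr mulmxDl mxE (quadratic_spectral _ sA) (quadratic_spectral _ sB).
have -> : m - frobenius_norm B = m * (\sum_i v i 0 ^+ 2)
    + - frobenius_norm B * (\sum_i v i 0 ^+ 2) by rewrite v1 !mulr1.
rewrite -{1}(sum_sqr_orthogonal v (proj1 sA)) -(sum_sqr_orthogonal v (proj1 sB)).
rewrite !mulr_sumr lerD // ler_sum // => i _; rewrite ler_wpM2r ?sqr_ge0 //.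
by have := norm_eigenvalue_le i sB; rewrite ler_norml => /andP[].
Qed.

(** [N] maps the eigenvectors of [N^T N] to those of [N N^T], stretched by the square roots of the
    eigenvalues. This allows passing to the Gram matrix whose diagonal is explicit. *)
Lemma is_spectral_gram_tr N O a : is_spectral (N^T *m N) O a ->
  (forall i, 0 < a 0 i) ->
  is_spectral (N *m N^T) (N *m O *m diag_mx (\row_i (Num.sqrt (a 0 i))^-1)) a.
Proof.
move=> sV a0; have OtO := is_spectral_trV sV; have [OO VE] := sV.
set D := diag_mx _.
have DaD : D *m diag_mx a *m D = 1%:M.
  rewrite /D !mulmx_diag; apply/matrixP => i j; rewrite !mxE; congr (_ *+ _).
  rewrite -{2}(@sqr_sqrtr _ (a 0 i)) ?ltW // expr2 mulrA.
  by rewrite mulVf ?mul1r ?mulfV // gt_eqF // sqrtr_gt0.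
have DT : D^T = D by rewrite tr_diag_mx.
split.
  apply: mulmx1C; rewrite !trmx_mul DT !mulmxA -![D *m O^T *m _ *m _]mulmxA VE.
  by rewrite !mulmxA -[D *m O^T *m O]mulmxA OtO mulmx1 -[_ *m O^T *m O]mulmxA OtO mulmx1.
rewrite !trmx_mul DT !mulmxA -[_ *m D *m diag_mx a]mulmxA -[_ *m (D *m _) *m D]mulmxA.
by rewrite DaD mulmx1 -[N *m O *m O^T]mulmxA OO mulmx1.
Qed.

(** A form of Jensen's inequality: [A i i] is the mean of the eigenvalues with weights [U i j ^+ 2].
    The tangent points [x i] stay free because the diagonal of [A] is later compared with the
    spectrum of another matrix. *)
Lemma trace_ge_diag_tangents g (x c : 'I_n -> R) A U a : is_spectral A U a ->
  (forall i j, g (x i) + c i * (a 0 j - x i) <= g (a 0 j)) ->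
  \sum_i (g (x i) + c i * (A i i - x i)) <= \sum_j g (a 0 j).
Proof.
move=> sA h; have UU := proj1 sA.
have w i : \sum_j U i j ^+ 2 = 1.
  have := congr1 (fun B : 'M[R]_n => B i i) UU; rewrite !mxE eqxx => e; rewrite -[RHS]e.
  by apply: eq_bigr => j _; rewrite [_^T _ _]mxE expr2.
have I1 : (1%:M : 'M[R]_n) *m 1%:M^T = 1%:M by rewrite trmx1 mulmx1.
rewrite -(sum_spectral_weightsC (fun j => g (a 0 j)) I1 UU).
apply: ler_sum => i _; rewrite trmx1 mul1mx.
have -> : A i i = \sum_j a 0 j * U i j ^+ 2.
  rewrite (proj2 sA) mxE; apply: eq_bigr => j _.
  by rewrite mul_mx_diag !mxE; ring.
have -> : g (x i) + c i * (\sum_j a 0 j * U i j ^+ 2 - x i) =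
   \sum_j (g (x i) + c i * (a 0 j - x i)) * U i j ^+ 2.
  rewrite mulrBr mulr_sumr addrCA addrC -[in LHS](mulr1 (g _ - _)) -(w i) mulr_sumr.
  by rewrite -big_split; apply: eq_bigr => j _ /=; ring.
by apply: ler_sum => j _; rewrite ler_wpM2r ?sqr_ge0.
Qed.

(* The traces of M^T W M and M^-1 W M^-T are read off on the Gram matrices with the
   diagonal entries w_i p_i and w_i q_i (in an eigenbasis of W), and p_i + q_i >= 2
   because p_i and q_i are squared norms of the i-th vectors of dual bases. *)
Lemma trace_congruence_mean g (c : R -> R) W M U1 U2 U w a b :
  is_spectral W U w -> (forall i, 0 < w 0 i) -> M \in unitmx ->
  is_spectral (M^T *m W *m M) U1 a -> (forall i, 0 < a 0 i) ->
  is_spectral (invmx M *m W *m (invmx M)^T) U2 b -> (forall i, 0 < b 0 i) ->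
  (forall x : R, 0 < x -> 0 <= c x) ->
  (forall x y : R, 0 < x -> 0 < y -> g x + c x * (y - x) <= g y) ->
  2 * (\sum_i g (w 0 i)) <= \sum_i g (a 0 i) + \sum_i g (b 0 i).
Proof.
move=> sW w0 Mu sA a0 sB b0 c0 gt.
(* For [N = D U^T K], the product [N^T N] is the congruence [K^T W K], while the diagonal of [N N^T]
   is [w i] times the squared norm of a row of [U^T K]. *)
pose D := diag_mx (map_mx Num.sqrt w).
have DT : D^T = D by rewrite tr_diag_mx.
have DD : D *m D = diag_mx w.
  rewrite /D mulmx_diag; congr diag_mx; apply/rowP => i.
  by rewrite !mxE -expr2 sqr_sqrtr // ltW.
have gram (K : 'M[R]_n) : (D *m (U^T *m K))^T *m (D *m (U^T *m K)) = K^T *m W *m K.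
  rewrite !trmx_mul DT trmxK !mulmxA -[_ *m D *m D]mulmxA DD (proj2 sW).
  by rewrite !mulmxA.
have diag (K : 'M[R]_n) i : (D *m (U^T *m K) *m (D *m (U^T *m K))^T) i i =
    w 0 i * \sum_k (U^T *m K) i k ^+ 2.
  rewrite mxE mulr_sumr; apply: eq_bigr => k _.
  rewrite [_^T _ _]mxE mul_diag_mx [X in X * X]mxE [map_mx _ _ _ _]mxE.
  by rewrite mulrACA -expr2 sqr_sqrtr ?ltW // expr2.
pose M' := (invmx M)^T.
rewrite -(gram M) in sA.
have {sB} : is_spectral (M'^T *m W *m M') U2 b by rewrite /M' trmxK.
rewrite -(gram M') => sB.
have := trace_ge_diag_tangents (g := g) (x := w 0) (c := fun i => c (w 0 i))
  (is_spectral_gram_tr sA a0) (fun i j => gt _ _ (w0 i) (a0 j)).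
have := trace_ge_diag_tangents (g := g) (x := w 0) (c := fun i => c (w 0 i))
  (is_spectral_gram_tr sB b0) (fun i j => gt _ _ (w0 i) (b0 j)).
move=> hB hA; apply: le_trans (lerD hA hB); rewrite -big_split mulr_sumr.
apply: ler_sum => i _ /=; rewrite !diag.
set p := \sum_k (U^T *m M) i k ^+ 2; set q := \sum_k (U^T *m M') i k ^+ 2.
have pq : 2 <= p + q.
  have : \sum_k (U^T *m M) i k * (U^T *m M') i k = 1.
    have /(congr1 (fun B : 'M[R]_n => B i i)) : (U^T *m M) *m (U^T *m M')^T = 1%:M.
      rewrite trmx_mul /M' !trmxK mulmxA mulmxK //.
      exact: is_spectral_trV sW.
    rewrite [LHS]mxE [RHS]mxE eqxx => e; rewrite -[RHS]e; apply: eq_bigr => k _.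
    by rewrite [(_ *m M')^T _ _]mxE.
  move=> h; rewrite -[2](mulr1) -h mulr_sumr -big_split /=.
  apply: ler_sum => k _; move: (_ i k) (_ i k) => x y.
  by have := sqr_ge0 (x - y); nra.
have := mulr_ge0 (c0 _ (w0 i)) (ltW (w0 i)).
set t := w 0 i; move=> ct.
have := mulr_ge0 ct (_ : 0 <= p + q - 2); rewrite subr_ge0 => /(_ pq); lra.
Qed.

End ScaledMatrices.

(** * Derivatives of the kernel function and its quadratic bounds *)

Section Kernel.
Variable R : realType.
Implicit Types (t s a b m x y d : R) (f df : R -> R).

(** Here and in the next three lemmas derivatives are required only from [m] on, because [psi] is
    singular at 0. *)
Lemma is_derive_continuous_itv f df m a b : m <= a ->
  (forall x, m <= x -> is_derive x 1 f (df x)) ->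
  {within `[a, b], continuous f}%classic.
Proof.
move=> ma fd; apply: derivable_within_continuous => x; rewrite in_itv /= => /andP[ax _].
exact: (@ex_derive _ _ _ _ _ _ _ (fd x (le_trans ma ax))).
Qed.

Lemma increment_le f df m (u : R) : (forall x, m <= x -> is_derive x 1 f (df x)) ->
  (forall x, m <= x -> df x <= u) ->
  forall a b, m <= a -> a <= b -> f b - f a <= u * (b - a).
Proof.
move=> fd dfu a b ma ab.
have [x|c cab ->] := MVT_segment ab (df := df) _ (is_derive_continuous_itv ma fd).
  by rewrite in_itv /= => /andP[ax _]; apply/fd/(le_trans ma)/ltW.
rewrite ler_wpM2r ?subr_ge0 // dfu //.
by move: cab; rewrite in_itv /= => /andP[/(le_trans ma)].
Qed.

Lemma increment_ge f df m (u : R) : (forall x, m <= x -> is_derive x 1 f (df x)) ->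
  (forall x, m <= x -> u <= df x) ->
  forall a b, m <= a -> a <= b -> u * (b - a) <= f b - f a.
Proof.
move=> fd dfu a b ma ab.
have [x|c cab ->] := MVT_segment ab (df := df) _ (is_derive_continuous_itv ma fd).
  by rewrite in_itv /= => /andP[ax _]; apply/fd/(le_trans ma)/ltW.
rewrite ler_wpM2r ?subr_ge0 // dfu //.
by move: cab; rewrite in_itv /= => /andP[/(le_trans ma)].
Qed.

(** Convexity in terms of a nondecreasing derivative. It is used for [psi] corrected by a quadratic,
    which yields both quadratic bounds on [psi]. *)
Lemma tangent_le f df m : (forall x, m <= x -> is_derive x 1 f (df x)) ->
  (forall x y, m <= x -> x <= y -> df x <= df y) ->
  forall a b, m <= a -> m <= b -> f a + df a * (b - a) <= f b.
Proof.
move=> fd dfm a b ma mb; case: (leP a b) => [ab|/ltW ba].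
  have := increment_ge (fun x ax => fd x (le_trans ma ax)) (fun x ax => dfm _ _ ma ax)
    (lexx a) ab; lra.
have [x|c cba] := MVT_segment ba (df := df) _ (is_derive_continuous_itv mb fd).
  by rewrite in_itv /= => /andP[ax _]; apply/fd/(le_trans mb)/ltW.
move: cba; rewrite in_itv /= => /andP[bc ca] fE.
have := ler_wpM2r (_ : 0 <= a - b) (dfm _ _ (le_trans mb bc) ca).
by rewrite subr_ge0 => /(_ ba); lra.
Qed.

Definition dpsi t : R := 2 * t - t^-1 ^+ 3 - t^-1 ^+ 2 * expR (t^-1 - 1).

Definition ddpsi t : R :=
  2 + 3 * t^-1 ^+ 4 + (2 * t^-1 ^+ 3 + t^-1 ^+ 4) * expR (t^-1 - 1).

Lemma is_derive_inv t : t != 0 -> is_derive t 1 (fun x : R => x^-1) (- t^-1 ^+ 2).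
Proof.
move=> t0; have := @is_deriveV R id t 1 1 t0 (is_derive_id _ _).
by rewrite -exprVn scaler1 /=.
Qed.

Lemma is_derive_exp_inv t : t != 0 ->
  is_derive t 1 (fun x : R => expR (x^-1 - 1)) (- t^-1 ^+ 2 * expR (t^-1 - 1)).
Proof.
move=> t0; have di := is_derive_inv t0.
have dg : is_derive t 1 (fun x : R => x^-1 - 1) (- t^-1 ^+ 2).
  have -> : (fun x : R => x^-1 - 1) = (fun x : R => x^-1) - cst 1 by apply/funext.
  by apply: is_derive_eq; rewrite subr0.
rewrite mulrC; exact: (@is_derive1_comp R expR (fun x => x^-1 - 1) t _ _ (is_derive_expR _) dg).
Qed.

Lemma is_derive_psi t : t != 0 -> is_derive t 1 (@psi R) (dpsi t).
Proof.
move=> t0; have di := is_derive_inv t0; have de := is_derive_exp_inv t0.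
have d1 : is_derive t 1 ((id : R -> R) ^+ 2) (2 * t).
  by apply: is_derive_eq; rewrite /GRing.scale /= mulr1.
have d2 : is_derive t 1 (2^-1 *: (fun x : R => x^-1) ^+ 2) (- t^-1 ^+ 3).
  by apply: is_derive_eq; rewrite /GRing.scale /=; field.
have -> : @psi R = ((id : R -> R) ^+ 2 + 2^-1 *: (fun x : R => x^-1) ^+ 2)
    + ((fun x : R => expR (x^-1 - 1)) - cst (5 / 2)).
  by apply/funext => x; rewrite /psi -exprVn !fctE /GRing.scale /=; lra.
have d3 := is_derive_cst (5 / 2 : R) t 1.
have d12 := is_deriveD d1 d2; have d34 := is_deriveB de d3.
by have d := is_deriveD d12 d34; apply: is_derive_eq; rewrite /dpsi; ring.
Qed.

Lemma is_derive_dpsi t : t != 0 -> is_derive t 1 dpsi (ddpsi t).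
Proof.
move=> t0; have di := is_derive_inv t0; have de := is_derive_exp_inv t0.
pose i x : R := x^-1; pose e x : R := expR (x^-1 - 1).
have -> : dpsi = 2 *: (id : R -> R) - i ^+ 3 - i ^+ 2 * e.
  by apply/funext => x; rewrite /dpsi /i /e !fctE /GRing.scale /=; ring.
by apply: is_derive_eq; rewrite /ddpsi /i /e !fctE /GRing.scale /=; ring.
Qed.

Lemma derive1_psi t : t != 0 -> derive1 (@psi R) t = dpsi t.
Proof. by move=> t0; have := is_derive_psi t0; rewrite derive1E => /@derive_val. Qed.

Lemma derive1n2_psi t : t != 0 -> derive1n 2 (@psi R) t = ddpsi t.
Proof.
move=> t0; rewrite derive1nS derive1n1 derive1E.
have := is_derive_dpsi t0 => /@derive_val <-.
(* [derive1 psi] is known to agree with [dpsi] only away from 0, hence on a neighbourhood of [t]. *)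
apply: near_eq_derive; near=> x; apply: derive1_psi; near: x.
exact: cvgr_neq0 cvg_id t0.
Unshelve. all: by end_near.
Qed.

Lemma ddpsi_ge2 t : 0 < t -> 2 <= ddpsi t.
Proof.
move=> t0; rewrite /ddpsi -addrA lerDl.
by rewrite addr_ge0 ?mulr_ge0 ?expR_ge0 ?addr_ge0 ?mulr_ge0 ?exprn_ge0 ?invr_ge0 ?ltW.
Qed.

Lemma ddpsi_nonincreasing x y : 0 < x -> x <= y -> ddpsi y <= ddpsi x.
Proof.
move=> x0 xy; have y0 := lt_le_trans x0 xy.
have yV : 0 <= y^-1 by rewrite invr_ge0 ltW.
have yx : y^-1 <= x^-1 by rewrite lef_pV2.
have P k : y^-1 ^+ k <= x^-1 ^+ k by rewrite lerXn2r // nnegrE (le_trans yV).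
rewrite /ddpsi lerD ?lerD ?ler_wpM2l // ler_pM ?expR_ge0 //.
- by rewrite addr_ge0 ?mulr_ge0 ?exprn_ge0.
- by rewrite lerD ?ler_wpM2l.
- by rewrite ler_expR lerD2r.
Qed.

Lemma dpsi_increment_ge a b : 0 < a -> a <= b -> 2 * (b - a) <= dpsi b - dpsi a.
Proof.
move=> a0 ab; apply: (increment_ge (f := dpsi) (u := 2) (df := ddpsi) (m := a)) => // x ax.
  by apply: is_derive_dpsi; rewrite gt_eqF // (lt_le_trans a0).
by apply: ddpsi_ge2; rewrite (lt_le_trans a0).
Qed.

Lemma dpsi_increment_le a b : 0 < a -> a <= b -> dpsi b - dpsi a <= ddpsi a * (b - a).
Proof.
move=> a0 ab; apply: (increment_le (f := dpsi) (u := ddpsi a) (df := ddpsi) (m := a)) => // x ax.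
  by apply: is_derive_dpsi; rewrite gt_eqF // (lt_le_trans a0).
exact: ddpsi_nonincreasing.
Qed.

(** [ddpsi m / 2 * x ^+ 2 - psi x] is convex from [m] on, since [ddpsi] is nonincreasing. *)
Lemma psi_le_quadratic m a b : 0 < m -> m <= a -> m <= b ->
  psi b <= psi a + dpsi a * (b - a) + ddpsi m / 2 * (b - a) ^+ 2.
Proof.
move=> m0 ma mb; pose c := ddpsi m.
pose f : R -> R := (c / 2) *: (id : R -> R) ^+ 2 - @psi R.
have fd x : m <= x -> is_derive x 1 f (c * x - dpsi x).
  move=> mx; have x0 : x != 0 by rewrite gt_eqF // (lt_le_trans m0).
  have := is_derive_psi x0 => dx; rewrite /f; apply: is_derive_eq.
  by rewrite /GRing.scale /=; field.
have dfm x y : m <= x -> x <= y -> c * x - dpsi x <= c * y - dpsi y.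
  move=> mx xy; have x0 := lt_le_trans m0 mx.
  have := dpsi_increment_le x0 xy.
  have := ler_wpM2r (_ : 0 <= y - x) (ddpsi_nonincreasing m0 mx).
  by rewrite subr_ge0 -/c => /(_ xy); lra.
have := tangent_le fd dfm ma mb; rewrite /f !fctE /GRing.scale /= -/c; lra.
Qed.

(** [psi x - x ^+ 2] is convex on the positive half-line, since [ddpsi >= 2]. *)
Lemma psi_ge_quadratic a b : 0 < a -> 0 < b ->
  psi a + dpsi a * (b - a) + (b - a) ^+ 2 <= psi b.
Proof.
move=> a0 b0; pose f : R -> R := @psi R - (id : R -> R) ^+ 2.
pose m := Num.min a b; have m0 : 0 < m by rewrite lt_min a0.
have fd x : m <= x -> is_derive x 1 f (dpsi x - 2 * x).
  move=> mx; have x0 : x != 0 by rewrite gt_eqF // (lt_le_trans m0).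
  have := is_derive_psi x0 => dx; rewrite /f; apply: is_derive_eq.
  by rewrite /GRing.scale /=; ring.
have dfm x y : m <= x -> x <= y -> dpsi x - 2 * x <= dpsi y - 2 * y.
  by move=> mx xy; have := dpsi_increment_ge (lt_le_trans m0 mx) xy; lra.
have := tangent_le fd dfm (_ : m <= a) (_ : m <= b).
rewrite !ge_min !lexx orbT => /(_ isT isT); rewrite /f !fctE /=; lra.
Qed.

End Kernel.

(** * Growth of the kernel, the inverse function [rho], and the decrease per step *)

Section KernelBounds.
Variable R : realType.
Implicit Types (t s a b m x y d : R).

Lemma psi1 : psi 1 = 0 :> R.
Proof. by rewrite /psi invr1 expr1n subrr expR0; lra. Qed.

Lemma dpsi1 : dpsi 1 = 0 :> R.
Proof. by rewrite /dpsi invr1 !expr1n subrr expR0; lra. Qed.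

Lemma psi_ge_sqr t : 0 < t -> (t - 1) ^+ 2 <= psi t.
Proof.
by move=> t0; have := psi_ge_quadratic ltr01 t0; rewrite psi1 dpsi1; lra.
Qed.

Lemma psi_ge0 t : 0 < t -> 0 <= psi t.
Proof. by move=> /psi_ge_sqr; apply: le_trans; exact: sqr_ge0. Qed.

(** Compare with the minimum [psi 1 = 0] in the strong convexity bound and complete the square.
    Summed over the eigenvalues, this gives [Psi <= delta ^+ 2]. *)
Lemma psi_le_dpsi_sqr t : 0 < t -> 4 * psi t <= dpsi t ^+ 2.
Proof.
move=> t0; have := psi_ge_quadratic t0 ltr01; rewrite psi1.
have := sqr_ge0 (dpsi t + 2 * (1 - t)); nra.
Qed.

Lemma dpsi_le x y : 0 < x -> x <= y -> dpsi x <= dpsi y.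
Proof. by move=> x0 xy; have := dpsi_increment_ge x0 xy; lra. Qed.

Lemma psi_nonincreasing x y : 0 < x -> x <= y -> y <= 1 -> psi y <= psi x.
Proof.
move=> x0 xy y1; have y0 := lt_le_trans x0 xy.
have := psi_ge_quadratic y0 x0; have := dpsi_le y0 y1; rewrite dpsi1.
have := sqr_ge0 (x - y); nra.
Qed.

Lemma psi_le_4sqr t : 1 <= t -> psi t <= 4 * (t - 1) ^+ 2.
Proof.
move=> t1; have := psi_le_quadratic ltr01 (lexx 1) t1.
by rewrite psi1 dpsi1 /ddpsi invr1 !expr1n subrr expR0; lra.
Qed.

(** Multiplying [t] by [b >= 1] increases only the term [t ^+ 2] of [psi]. *)
Lemma psi_scale_le t b : 0 < t -> 1 <= b -> psi (b * t) <= psi t + (b ^+ 2 - 1) * t ^+ 2.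
Proof.
move=> t0 b1; have b0 : 0 < b by lra.
have btV : (b * t)^-1 <= t^-1 by rewrite lef_pV2 ?posrE ?mulr_gt0 // ler_peMl // ltW.
have bt0 : 0 <= (b * t)^-1 by rewrite invr_ge0 ltW // mulr_gt0.
have h2 : (b * t)^-1 ^+ 2 <= t^-1 ^+ 2 by rewrite lerXn2r // nnegrE (le_trans bt0).
have h3 : expR ((b * t)^-1 - 1) <= expR (t^-1 - 1) by rewrite ler_expR lerD2r.
rewrite /psi -[((b * t) ^+ 2)^-1]exprVn -[(t ^+ 2)^-1]exprVn exprMn; lra.
Qed.

(** Summed over the eigenvalues with one well-chosen [k], this takes the place of the Cauchy-Schwarz
    inequality for the sum of the deviations [u]. *)
Lemma amgm_weighted (k u p : R) : 0 < k -> u ^+ 2 <= p -> 2 * u <= k + p / k.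
Proof.
move=> k0 up; apply: le_trans (_ : k + u ^+ 2 / k <= _); last first.
  by rewrite lerD2l ler_wpM2r // invr_ge0 ltW.
rewrite -subr_ge0; have -> : k + u ^+ 2 / k - 2 * u = (k - u) ^+ 2 / k.
  by field; rewrite gt_eqF.
by rewrite divr_ge0 ?sqr_ge0 // ltW.
Qed.

Lemma psi_scale_le_quadratic t b k : 0 < t -> 1 <= b -> 0 < k ->
  psi (b * t) <= 4 * ((b - 1) ^+ 2 + (b - 1) * b * (k + psi t / k) + b ^+ 2 * psi t).
Proof.
move=> t0 b1 k0; have b0 : 0 < b by lra.
have p0 := psi_ge0 t0; have pk : 0 <= psi t / k by rewrite divr_ge0 // ltW.
have c0 : 0 <= (b - 1) * b * (k + psi t / k).
  rewrite mulr_ge0 ?addr_ge0 ?(ltW k0) //.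
  by rewrite mulr_ge0 ?(ltW b0) // subr_ge0.
have b2 : psi t <= b ^+ 2 * psi t.
  by rewrite ler_peMl // exprn_ege1.
have q0 := sqr_ge0 (b - 1).
have [bt1|bt1] := leP (b * t) 1.
  have : psi (b * t) <= psi t by rewrite psi_nonincreasing // ler_peMl // ltW.
  lra.
apply: le_trans (psi_le_4sqr (ltW bt1)) _; rewrite ler_pM2l //.
have [t1|t1] := leP 1 t; last first.
  suff : (b * t - 1) ^+ 2 <= (b - 1) ^+ 2 by lra.
  by rewrite lerXn2r ?nnegrE; nra.
have u2 := psi_ge_sqr t0; set u := t - 1 in u2.
have -> : b * t - 1 = (b - 1) + b * u by rewrite /u; ring.
have amgm := amgm_weighted k0 u2.
have h1 : (b - 1) * b * (2 * u) <= (b - 1) * b * (k + psi t / k).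
  by rewrite ler_wpM2l // mulr_ge0 ?subr_ge0 // ltW.
have h2 : b ^+ 2 * u ^+ 2 <= b ^+ 2 * psi t by rewrite ler_wpM2l ?sqr_ge0.
have -> : (b - 1 + b * u) ^+ 2 = (b - 1) ^+ 2 + (b - 1) * b * (2 * u) + b ^+ 2 * u ^+ 2.
  by ring.
lra.
Qed.

(** [1 - w = theta / (1 + w)], and [1 + w] is at least the square root of 2 as long as [theta] does
    not exceed 2 sqrt 2 - 2, which is slightly above 4/5. *)
Lemma one_sub_sqrt_le (theta w r : R) : 0 < theta -> theta <= 4 / 5 ->
  0 < w -> w ^+ 2 = 1 - theta -> 0 < r -> r ^+ 2 = 2 -> 1 - w <= theta / r.
Proof.
move=> th0 th w0 w2 r0 r2.
have w1 : w <= 1 by nra.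
have w25 : 2 / 5 <= w by nra.
have rw : r <= 1 + w by nra.
rewrite ler_pdivlMr //; have -> : theta = (1 - w) * (1 + w).
  by rewrite -[LHS](subKr 1) -w2; ring.
by apply: ler_wpM2l; lra.
Qed.

Lemma rho_spec y : 0 <= y -> [/\ 0 < rho y, rho y <= 1 & dpsi (rho y) = - 2 * y].
Proof.
move=> y0; pose f t : R := - 2^-1 * derive1 (@psi R) t.
pose A := [set t : R | 0 < t <= 1]%classic; pose B := [set y : R | 0 <= y]%classic.
have fE t : 0 < t -> f t = - 2^-1 * dpsi t.
  by move=> t0; rewrite /f derive1_psi // gt_eqF.
have fsurj : set_surj A B f.
  move=> z; rewrite /B /= => z0; pose a : R := (2 * z + 2)^-1.
  (* At this [a] the cubic term alone suffices: [a^-1 ^+ 3] is at least [4 * (2 * z + 2)], hence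
     [dpsi a <= - 2 * z]. *)
  have a0 : 0 < a by rewrite invr_gt0; lra.
  have a1 : a <= 1 by rewrite invf_le1; lra.
  have [||t] := @IVT R (@dpsi R) a 1 (- 2 * z) a1.
  - apply: (is_derive_continuous_itv (df := @ddpsi R) (lexx a)) => x ax.
    by apply: is_derive_dpsi; rewrite gt_eqF // (lt_le_trans a0).
  - rewrite dpsi1 ge_min le_max; apply/andP; split; last by apply/orP; right; lra.
    apply/orP; left; rewrite /dpsi.
    have aV : a^-1 = 2 * z + 2 by rewrite invrK.
    have aaV : a * a^-1 = 1 by rewrite mulfV // gt_eqF.
    rewrite aV in aaV *; have e0 := expR_ge0 (2 * z + 2 - 1).
    have := mulr_ge0 (sqr_ge0 (2 * z + 2)) e0.
    have : (2 * z + 2) * 4 <= (2 * z + 2) ^+ 3.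
      rewrite exprS ler_pM2l; last lra.
      by nra.
    lra.
  rewrite in_itv /= => /andP[at' t1] tE; exists t; rewrite /A /=.
    by rewrite t1 (lt_le_trans a0).
  by rewrite -[RHS](_ : f t = z) // fE ?tE ?(lt_le_trans a0) //; lra.
have : A (rho y) by apply: (surjpinv_image_sub fsurj); exists y.
move=> /= /andP[r0 r1]; split => //.
have := surjpK (fun=> 1) fsurj (_ : y \in B); rewrite inE => /(_ y0).
by rewrite -/(rho y) fE //; lra.
Qed.

Lemma ln_le_sub1 x : 0 < x -> ln x <= x - 1.
Proof. by move=> x0; have := @le_ln1Dx R (x - 1); rewrite addrCA subrr addr0; apply; lra. Qed.

(** From e^(-1/3) >= 2/3 follows e <= 27/8 < 15/4. The threshold 15/4 has to lie below
    [4 * sqrt (p / 2) + 1] for all [p >= 1]. *)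
Lemma ln_ge1 x : 15 / 4 <= x -> 1 <= ln x.
Proof.
move=> x4; have x0 : 0 < x by lra.
have e3 : expR (- 3^-1 : R) ^+ 3 = (expR 1)^-1.
  by rewrite -expRM_natl -expRN; congr expR; rewrite -mulr_natl; lra.
have e1 : 2 / 3 <= expR (- 3^-1 : R).
  by have := expR_ge1Dx (- 3^-1 : R); lra.
have e2 : 8 / 27 <= (expR 1 : R)^-1.
  rewrite -e3; have -> : 8 / 27 = (2 / 3) ^+ 3 :> R by field.
  by rewrite lerXn2r // nnegrE ?expR_ge0 //; lra.
have e4 : expR 1 <= x.
  apply: le_trans x4; rewrite -[expR 1]invrK.
  apply: le_trans (_ : (8 / 27)^-1 <= _); last lra.
  by rewrite lef_pV2 ?posrE ?invr_gt0 ?expR_gt0 //; lra.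
by rewrite -[1]expRK ler_ln ?posrE ?expR_gt0.
Qed.

(** With [s = t^-1], the equation [dpsi t = - 4 * d] serves twice: it bounds the exponential by
    [4 * d + 1], so [s <= 1 + ln (4 * d + 1)], and it eliminates the exponential from [ddpsi t],
    leaving a polynomial in [s] and [d]. *)
Lemma ddpsi_rho_le d : 1 <= d ->
  ddpsi (rho (2 * d)) <= 41 / 4 * d * (1 + ln (4 * d + 1)) ^+ 2.
Proof.
move=> d1; have [|t0 t1] := @rho_spec (2 * d); first lra.
set t := rho _ in t0 t1 *; rewrite /dpsi /ddpsi.
set s := t^-1; set e := expR _; set S := 1 + ln _ => tE.
have ts : t * s = 1 by rewrite mulfV // gt_eqF.
have s1 : 1 <= s by rewrite /s invf_ge1.
have e0 : 0 < e := expR_gt0 _.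
have s2e : s ^+ 2 * e = 4 * d + 2 * t - s ^+ 3 by lra.
have ele : e <= 4 * d + 1.
  have : e <= s ^+ 2 * e by rewrite ler_peMl ?(ltW e0) // exprn_ege1 //; lra.
  have : 1 <= s ^+ 3 by rewrite exprn_ege1 //; lra.
  lra.
have sS : s <= S.
  by rewrite /S -lerBlDl -[s - 1]expRK ler_ln ?posrE //; lra.
have S2 : 2 <= S by have := @ln_ge1 (4 * d + 1); rewrite /S; lra.
have -> : (2 * s ^+ 3 + s ^+ 4) * e = (2 * s + s ^+ 2) * (s ^+ 2 * e) by ring.
rewrite s2e.
have -> : 2 + 3 * s ^+ 4 + (2 * s + s ^+ 2) * (4 * d + 2 * t - s ^+ 3) =
   2 + s ^+ 4 + 4 * (t * s) + 2 * (t * s) * s - s ^+ 5 + 4 * d * (2 * s + s ^+ 2) by ring.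
rewrite ts.
have h5 : s - 1 <= s ^+ 5 - s ^+ 4.
  have -> : s ^+ 5 - s ^+ 4 = s ^+ 4 * (s - 1) by ring.
  by rewrite ler_peMl ?subr_ge0 // exprn_ege1 //; lra.
have h6 : 7 + s <= d * (7 + S).
  apply: le_trans (_ : 1 * (7 + S) <= _); first by lra.
  by rewrite ler_wpM2r //; lra.
have h7 : 4 * d * (2 * s + s ^+ 2) <= 4 * d * (2 * S + S ^+ 2).
  rewrite ler_wpM2l ?lerD //; [lra|lra|].
  by rewrite lerXn2r // nnegrE; lra.
(* 41/4 is the least constant here: [7 + 9 S + 4 S ^+ 2 <= 41/4 * S ^+ 2] is an equality at
   [S = 2]. *)
have h8 : d * (7 + S) + 4 * d * (2 * S + S ^+ 2) <= 41 / 4 * d * S ^+ 2.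
  have -> : d * (7 + S) + 4 * d * (2 * S + S ^+ 2) = d * (7 + 9 * S + 4 * S ^+ 2) by ring.
  have -> : 41 / 4 * d * S ^+ 2 = d * (41 / 4 * S ^+ 2) by ring.
  by rewrite ler_wpM2l; [|lra|nra].
lra.
Qed.

(** [d / (1 + ln (4 d + 1)) ^+ 2] is smallest at [d0], so a lower bound on [delta] can be
    substituted. Writing [d = d0 * r ^+ 2], the logarithm grows by at most [2 * (r - 1)], and
    [S0 >= 2] gives [S0 + 2 * (r - 1) <= r * S0]. *)
Lemma sqr_ln_growth d0 d : 0 < d0 -> d0 <= d -> 1 <= ln (4 * d0 + 1) ->
  d0 * (1 + ln (4 * d + 1)) ^+ 2 <= d * (1 + ln (4 * d0 + 1)) ^+ 2.
Proof.
move=> d0_gt0 dd S2; set S0 := 1 + ln (4 * d0 + 1).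
have d_gt0 : 0 < d by lra.
pose r := Num.sqrt (d / d0).
have r2 : r ^+ 2 = d / d0 by rewrite sqr_sqrtr // divr_ge0 // ltW.
have r1 : 1 <= r by rewrite -sqrtr1 ler_wsqrtr // ler_pdivlMr // mul1r.
have dE : d = d0 * r ^+ 2 by rewrite r2 mulrCA mulfV ?mulr1 // gt_eqF.
have lnle : ln (4 * d + 1) <= ln (4 * d0 + 1) + 2 * (r - 1).
  apply: le_trans (_ : ln ((4 * d0 + 1) * r ^+ 2) <= _).
    rewrite ler_ln ?posrE ?mulr_gt0 ?exprn_gt0 //; try lra.
    rewrite dE; have : 1 <= r ^+ 2 by rewrite exprn_ege1 //; lra.
    by lra.
  rewrite lnM ?posrE ?exprn_gt0 //; try lra.
  rewrite lerD2l lnXn; last lra.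
  by have := @ln_le_sub1 r; rewrite mulr2n; lra.
rewrite [X in _ <= X * _]dE -mulrA ler_pM2l // -exprMn lerXn2r // ?nnegrE.
- have : 0 <= ln (4 * d + 1) by rewrite ln_ge0; lra.
  lra.
- by rewrite mulr_ge0 // /S0; lra.
- rewrite /S0; nra.
Qed.

(* The left-hand side is the lower bound d / (41 / 4 * (1 + ln (4 d + 1)) ^ 2) at
   d = sqrt (p / 2), rounded down. *)
Lemma default_decrease_ge p d : 1 <= p -> Num.sqrt p <= d ->
  2 / (29 * (1 + ln (2 * Num.sqrt (2 * p) + 1)) ^+ 2) * Num.sqrt p
  <= d ^+ 2 / ddpsi (rho (2 * d)).
Proof.
move=> p1 pd; set x := Num.sqrt p in pd *.
have x2 : x ^+ 2 = p by rewrite sqr_sqrtr //; lra.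
have x1 : 1 <= x by rewrite -sqrtr1 ler_wsqrtr.
have -> : Num.sqrt (2 * p) = Num.sqrt 2 * x by rewrite sqrtrM.
set r2 := Num.sqrt 2.
have r22 : r2 ^+ 2 = 2 by rewrite sqr_sqrtr.
have r20 : 0 <= r2 := sqrtr_ge0 _.
have rlo : 7 / 5 <= r2 by nra.
(* This rational bound turns [41 / 2 * r2] into the constant 29. *)
have rhi : r2 <= 58 / 41 by nra.
(* [d >= sqrt p] is weakened to [sqrt (p / 2)] so that [4 * d0 + 1] is exactly the argument of the
   logarithm in the claim. *)
pose d0 := r2 * x / 2.
have -> : 2 * (r2 * x) + 1 = 4 * d0 + 1 by rewrite /d0; lra.
have d0_gt0 : 0 < d0 by rewrite /d0; nra.
have d0d : d0 <= d by rewrite /d0; nra.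
have d1 : 1 <= d by lra.
have l1 : 1 <= ln (4 * d0 + 1) by apply: ln_ge1; rewrite /d0; nra.
have := sqr_ln_growth d0_gt0 d0d l1; have := ddpsi_rho_le d1.
set S := 1 + ln (4 * d + 1); set S0 := 1 + ln (4 * d0 + 1); set c := ddpsi _ => cS SS0.
have c0 : 0 < c.
  have [|r0 _ _] := @rho_spec (2 * d); first lra.
  by have := ddpsi_ge2 r0; rewrite -/c; lra.
have S0_gt0 : 0 < S0 by rewrite /S0; lra.
rewrite mulrAC ler_pdivrMr; last by rewrite mulr_gt0 // exprn_gt0.
rewrite mulrAC ler_pdivlMr //.
apply: le_trans (_ : 2 * x * (41 / 4 * d * S ^+ 2) <= _).
  by rewrite ler_wpM2l //; lra.
have -> : 2 * x * (41 / 4 * d * S ^+ 2) = 41 / 2 * r2 * d * (d0 * S ^+ 2).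
  rewrite /d0; transitivity (41 / 4 * r2 ^+ 2 * x * d * S ^+ 2); last by field.
  by rewrite r22; field.
apply: le_trans (_ : 29 * d * (d0 * S ^+ 2) <= _).
  apply: ler_wpM2r; first by rewrite mulr_ge0 ?sqr_ge0 ?(ltW d0_gt0).
  by apply: ler_wpM2r; lra.
have -> : d ^+ 2 * (29 * S0 ^+ 2) = 29 * d * (d * S0 ^+ 2) by ring.
by rewrite ler_wpM2l //; lra.
Qed.

End KernelBounds.

(** * The scaling matrix, the scaled Newton system and the change of scaling *)

Section Scaling.
Variables (R : realType) (n : nat).
Implicit Types (A B U W M N X Y V D Z : 'M[R]_n) (L : {linear 'M[R]_n -> 'M[R]_n}).

(** With [T ^2 = H Y H], the two inverses of [T] cancel [H Y H] and leave [H H = X]. The equation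
    [P Y P = X] is what makes the scaled [X] and the scaled [Y] the same matrix [V]. *)
Lemma scalingP_spec X Y : posdefmx X -> posdefmx Y ->
  posdefmx (scalingP X Y) /\ scalingP X Y *m Y *m scalingP X Y = X.
Proof.
move=> Xpos Ypos; rewrite /scalingP /=.
have := posdefmx_sqrt Xpos; have := mulmx_sqrt Xpos.
set H := mxsqrt X; clearbody H => HH Hpos.
have Spos : posdefmx (H *m Y *m H) := posdefmx_congr_sym Ypos Hpos.
have := posdefmx_sqrt Spos; have := mulmx_sqrt Spos.
set T := mxsqrt _; clearbody T => TT Tpos; have Tu := posdefmx_unit Tpos.
split; first exact: posdefmx_congr_sym (posdefmx_inv Tpos) Hpos.
rewrite !mulmxA -[_ *m H *m Y]mulmxA -[_ *m (H *m Y) *m H]mulmxA -TT !mulmxA.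
by rewrite mulmxKV // -[H *m _ *m _]mulmxA mulmxV // mulmx1.
Qed.

Lemma scaledV_spec X Y (mu : R) : posdefmx X -> posdefmx Y -> 0 < mu ->
  let D := scalingD X Y in let V := scaledV X Y mu in
  [/\ posdefmx D, posdefmx V, X = Num.sqrt mu *: (D *m V *m D)
    & Y = Num.sqrt mu *: (invmx D *m V *m invmx D)].
Proof.
move=> Xpos Ypos mu0; rewrite /scaledV /=.
have [Ppos PYP] := scalingP_spec Xpos Ypos.
have Dpos : posdefmx (scalingD X Y) := posdefmx_sqrt Ppos.
have DD : scalingD X Y *m scalingD X Y = scalingP X Y := mulmx_sqrt Ppos.
move: Dpos DD; set D := scalingD X Y; clearbody D => Dpos DD.
have Du := posdefmx_unit Dpos.
have s0 : Num.sqrt mu != 0 by rewrite gt_eqF // sqrtr_gt0.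
split=> //.
- apply: posdefmxZ; first by rewrite invr_gt0 sqrtr_gt0.
  exact: posdefmx_congr_sym (posdefmx_inv Dpos).
- rewrite -scalemxAr -scalemxAl scalerA mulfV // scale1r.
  by rewrite !mulmxA mulmxV // mul1mx mulmxKV.
rewrite -scalemxAr -scalemxAl scalerA mulfV // scale1r.
rewrite -PYP -DD !mulmxA mulmxKV // mulVmx // mul1mx.
by rewrite -[_ *m D *m invmx D]mulmxA mulmxV // mulmx1 mulmxK.
Qed.

Lemma mxtrace_symmetric_sqr_ge0 A : A \is symmetricmx -> 0 <= \tr (A *m A).
Proof.
move=> /eigendecompositionP sA; rewrite (mxtrace_spectral (is_spectral_mul sA sA)).
by apply: sumr_ge0 => i _; rewrite mxE -expr2 sqr_ge0.
Qed.

Lemma mxtrace_symmetric_sqr_eq0 A : A \is symmetricmx -> \tr (A *m A) <= 0 -> A = 0.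
Proof.
move=> /eigendecompositionP sA; rewrite (mxtrace_spectral (is_spectral_mul sA sA)).
move=> le0; have [_ ->] := sA; suff -> : (eigendecomposition A).2 = 0.
  suff -> : diag_mx 0 = 0 :> 'M[R]_n by rewrite mulmx0 mul0mx.
  by apply/matrixP => i j; rewrite !mxE mul0rn.
have ge0 i : true -> 0 <= (\row_i ((eigendecomposition A).2 0 i * (eigendecomposition A).2 0 i)) 0 i.
  by move=> _; rewrite mxE -expr2 sqr_ge0.
have /eqP : \sum_i (\row_i ((eigendecomposition A).2 0 i * (eigendecomposition A).2 0 i)) 0 i = 0.
  by apply/eqP; rewrite eq_le le0 sumr_ge0.
rewrite psumr_eq0 // => /allP h; apply/rowP => i.
by have := h i (mem_index_enum i); rewrite !mxE /= mulf_eq0 orbb => /eqP.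
Qed.

Lemma symmetricmx_congr D Z : D \is symmetricmx -> Z \is symmetricmx ->
  D *m Z *m D \is symmetricmx.
Proof.
move=> /symmetricmxP DT /symmetricmxP ZT; apply/symmetricmxP.
by rewrite !trmx_mul DT ZT mulmxA.
Qed.

Lemma symmetricmxD A B : A \is symmetricmx -> B \is symmetricmx ->
  A + B \is symmetricmx.
Proof.
move=> /symmetricmxP AT /symmetricmxP BT; apply/symmetricmxP.
by rewrite linearD /= AT BT.
Qed.

Lemma symmetricmxZ (c : R) A : A \is symmetricmx -> c *: A \is symmetricmx.
Proof.
by move=> /symmetricmxP AT; apply/symmetricmxP; rewrite linearZ /= AT.
Qed.

Lemma monotone_scaled L D Z : monotone_mx L -> D \is symmetricmx ->
  Z \is symmetricmx -> 0 <= \tr (Z *m (D *m L (D *m Z *m D) *m D)).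
Proof.
move=> Lmono Dsym Zsym.
have -> : \tr (Z *m (D *m L (D *m Z *m D) *m D)) = \tr (D *m Z *m D *m L (D *m Z *m D)).
  by rewrite !mulmxA mxtrace_mulC !mulmxA.
exact/Lmono/symmetricmx_congr.
Qed.

(* Z + D L(D Z D) D is injective on symmetric matrices by monotonicity; precomposing
   the second term with the symmetrization makes it an injective endomorphism of the
   space of all matrices, hence a surjective one. *)
Lemma scaled_system_solvable L D B :
  (forall Z, Z \is symmetricmx -> L Z \is symmetricmx) -> monotone_mx L ->
  D \is symmetricmx -> B \is symmetricmx ->
  exists2 Z, Z \is symmetricmx & Z + D *m L (D *m Z *m D) *m D = B.
Proof.
move=> Lsym Lmono Dsym Bsym.
pose s Z : 'M[R]_n := 2^-1 *: (Z + Z^T).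
have s_sym Z : s Z \is symmetricmx.
  by apply: symmetricmxZ; apply/symmetricmxP; rewrite linearD /= trmxK addrC.
have s_id Z : Z \is symmetricmx -> s Z = Z.
  move=> /symmetricmxP ZT; rewrite /s ZT.
  by apply/matrixP => i j; rewrite !mxE; lra.
pose t Z := D *m L (D *m s Z *m D) *m D.
have t_sym Z : t Z \is symmetricmx.
  exact/symmetricmx_congr/Lsym/symmetricmx_congr.
pose T Z := Z + t Z.
have T_lin : linear T.
  move=> k u v; have sE : s (k *: u + v) = k *: s u + s v.
    by apply/matrixP => i j; rewrite !mxE; ring.
  rewrite /T /t sE mulmxDr mulmxDl -scalemxAr -scalemxAl linearD linearZ /=.
  by rewrite mulmxDr mulmxDl -scalemxAr -scalemxAl scalerDr addrACA.
have T_ker Z : T Z = 0 -> Z = 0.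
  move=> /eqP; rewrite addr_eq0 => /eqP ZE.
  have Zsym : Z \is symmetricmx.
    by rewrite ZE -scaleN1r symmetricmxZ.
  apply: mxtrace_symmetric_sqr_eq0 => //; rewrite {2}ZE mulmxN raddfN oppr_le0.
  by rewrite /t s_id // monotone_scaled.
pose TL : {linear 'M[R]_n -> 'M[R]_n} :=
  HB.pack T (GRing.isLinear.Build _ _ _ _ T T_lin).
have lk0 : lker (linfun TL) == 0%VS.
  apply/lker0P => Z1 Z2; rewrite !lfunE /= => eqT; apply/eqP.
  rewrite -subr_eq0; apply/eqP/T_ker.
  by have /= -> := linearB TL Z1 Z2; rewrite eqT subrr.
pose Z : 'M[R]_n := (linfun TL)^-1%VF B.
have ZB : T Z = B.
  by have := lker0_lfunVK lk0 B; rewrite lfunE.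
have Zsym : Z \is symmetricmx.
  have -> : Z = B + -1 *: t Z by rewrite -ZB scaleN1r /T addrK.
  exact/symmetricmxD/symmetricmxZ.
by exists Z => //; rewrite -ZB /T /t s_id.
Qed.

Lemma scaled_direction_spec L X Y (mu : R) :
  (forall Z, Z \is symmetricmx -> L Z \is symmetricmx) -> monotone_mx L ->
  posdefmx X -> posdefmx Y -> 0 < mu ->
  let D := scalingD X Y in let d := scaled_direction L X Y mu in
  [/\ d.1 \is symmetricmx, d.2 \is symmetricmx,
     d.1 + d.2 = - mxfun (derive1 (@psi R)) (scaledV X Y mu)
   & D *m L (D *m d.1 *m D) *m D = d.2].
Proof.
move=> Lsym Lmono Xpos Ypos mu0 D d.
have [[Dsym _] [Vsym _] _ _] := scaledV_spec Xpos Ypos mu0.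
set V := scaledV X Y mu; have sV := eigendecompositionP Vsym.
have fsym : - mxfun (derive1 (@psi R)) V \is symmetricmx.
  by rewrite -scaleN1r symmetricmxZ // (is_spectral_sym (is_spectral_mxfun _ sV)).
have [Z Zsym ZE] := scaled_system_solvable Lsym Lmono Dsym fsym.
apply: (@xgetPex _ (0, 0) [set d : 'M[R]_n * 'M[R]_n |
    [/\ d.1 \is symmetricmx, d.2 \is symmetricmx,
        d.1 + d.2 = - mxfun (derive1 (@psi R)) (scaledV X Y mu)
      & D *m L (D *m d.1 *m D) *m D = d.2]]%classic).
exists (Z, D *m L (D *m Z *m D) *m D); split => //.
exact/symmetricmx_congr/Lsym/symmetricmx_congr.
Qed.

(* M is D' D^-1, with D' the scaling of the pair (X, Y) itself. *)
Lemma scaledV_update X Y D V1 V2 (mu : R) : posdefmx X -> posdefmx Y -> 0 < mu ->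
  posdefmx D -> X = Num.sqrt mu *: (D *m V1 *m D) ->
  Y = Num.sqrt mu *: (invmx D *m V2 *m invmx D) ->
  let V' := scaledV X Y mu in
  exists2 M, M \in unitmx &
    V1 = M^T *m V' *m M /\ V2 = invmx M *m V' *m (invmx M)^T.
Proof.
move=> Xpos Ypos mu0 Dpos XE YE V'; have Du := posdefmx_unit Dpos.
have := scaledV_spec Xpos Ypos mu0; rewrite /= -/V'.
set D' := scalingD X Y; clearbody V' D'; rewrite XE YE => -[D'pos _ X2 Y2].
have D'u := posdefmx_unit D'pos.
have s0 : Num.sqrt mu != 0 by rewrite gt_eqF // sqrtr_gt0.
have {}X2 := scalerI s0 X2; have {}Y2 := scalerI s0 Y2.
exists (D' *m invmx D); first by rewrite unitmx_mul D'u unitmx_inv.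
have ME : invmx (D' *m invmx D) = D *m invmx D'.
  by rewrite -[D *m _](mulKmx (_ : D' *m invmx D \in unitmx)) ?unitmx_mul ?D'u ?unitmx_inv //
     !mulmxA mulmxKV // mulmxK // mulmx1.
rewrite ME !trmx_mul !trmx_inv (posdefmx_tr Dpos) (posdefmx_tr D'pos).
split.
  have -> : invmx D *m D' *m V' *m (D' *m invmx D) =
     invmx D *m (D' *m V' *m D') *m invmx D by rewrite !mulmxA.
  by rewrite -X2 !mulmxA mulVmx // mul1mx mulmxK.
have -> : D *m invmx D' *m V' *m (invmx D' *m D) =
   D *m (invmx D' *m V' *m invmx D') *m D by rewrite !mulmxA.
by rewrite -Y2 !mulmxA mulmxV // mul1mx mulmxKV.
Qed.

End Scaling.

(** * The proximity measure and its behaviour under perturbation and congruence *)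

Section Proximity.
Variables (R : realType) (n : nat).
Implicit Types (A B E U W M X Y V D Z : 'M[R]_n) (d a b w : 'rV[R]_n).

Lemma Psi_spectral V U d : is_spectral V U d -> Psi V = \sum_i psi (d 0 i).
Proof.
move=> sV; rewrite /Psi (mxtrace_spectral (is_spectral_mxfun _ sV)).
by apply: eq_bigr => i _; rewrite mxE.
Qed.

Lemma Psi_ge0 V : posdefmx V -> 0 <= Psi V.
Proof.
move=> /posdefmxP[U [d sV d0]]; rewrite (Psi_spectral sV).
by apply: sumr_ge0 => i _; exact: psi_ge0.
Qed.

Lemma mxfun_derive1_psi V : posdefmx V ->
  mxfun (derive1 (@psi R)) V = mxfun (@dpsi R) V.
Proof.
move=> /posdefmxP[U [d sV d0]]; rewrite !(mxfunE _ sV); congr (_ *m diag_mx _ *m _).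
by apply/rowP => i; rewrite !mxE derive1_psi // gt_eqF.
Qed.

Lemma delta_ge0 V : 0 <= delta V.
Proof. by rewrite mulr_ge0 ?invr_ge0 // sqrtr_ge0. Qed.

Lemma delta_sqr V U d : is_spectral V U d -> (forall i, 0 < d 0 i) ->
  4 * delta V ^+ 2 = \sum_i dpsi (d 0 i) ^+ 2.
Proof.
move=> sV d0; have Vpos := (posdefmx_spectral sV).2 d0.
rewrite /delta mxfun_derive1_psi // (frobenius_norm_sym (is_spectral_mxfun _ sV)).
rewrite exprMn sqr_sqrtr; last by apply: sumr_ge0 => i _; exact: sqr_ge0.
have -> (x : R) : 4 * (2^-1 ^+ 2 * x) = x by field.
by apply: eq_bigr => i _; rewrite mxE.
Qed.

Lemma mxtrace_dpsi_sqr V : posdefmx V ->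
  \tr (mxfun (@dpsi R) V *m mxfun (@dpsi R) V) = 4 * delta V ^+ 2.
Proof.
move=> /posdefmxP[U [d sV d0]]; rewrite (delta_sqr sV d0).
have sf := is_spectral_mxfun (@dpsi R) sV.
by rewrite (mxtrace_spectral (is_spectral_mul sf sf)); apply: eq_bigr => i _; rewrite !mxE.
Qed.

Lemma sqrt_Psi_le_delta V : posdefmx V -> Num.sqrt (Psi V) <= delta V.
Proof.
move=> Vpos; have [U [d sV d0]] := posdefmxP Vpos.
rewrite -[leRHS]ger0_norm ?delta_ge0 // -sqrtr_sqr ler_wsqrtr //.
rewrite -(ler_pM2l (_ : 0 < 4)) // (delta_sqr sV d0) (Psi_spectral sV) mulr_sumr.
by apply: ler_sum => i _; exact: psi_le_dpsi_sqr.
Qed.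

(** [dpsi] is at least [- 2 delta] at an eigenvalue and equals [- 4 delta] at [rho (2 * delta V)];
    its slope in between is at most [ddpsi (rho (2 * delta V))], so the two points are this far
    apart. *)
Lemma eigenvalue_ge_rho V U d i : is_spectral V U d -> (forall i, 0 < d 0 i) ->
  rho (2 * delta V) + 2 * delta V / ddpsi (rho (2 * delta V)) <= d 0 i.
Proof.
move=> sV d0; have dge0 := delta_ge0 V.
have [|t0 t1 tE] := @rho_spec R (2 * delta V); first by rewrite mulr_ge0.
set t := rho _ in t0 t1 tE *; set l := d 0 i.
have ld : - (2 * delta V) <= dpsi l.
  have sq : dpsi l ^+ 2 <= 4 * delta V ^+ 2.
    rewrite (delta_sqr sV d0) (bigD1 i) //= lerDl.
    by apply: sumr_ge0 => j _; exact: sqr_ge0.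
  by rewrite leNgt; apply/negP => lt; nra.
have tl : t <= l.
  have [//|lt] := leP t l.
  by have := dpsi_increment_ge (d0 i) (ltW lt); rewrite -/l; lra.
have c0 : 0 < ddpsi t by have := ddpsi_ge2 t0; lra.
have h := dpsi_increment_le t0 tl; rewrite -lerBrDl ler_pdivrMr // [_ * ddpsi t]mulrC.
lra.
Qed.

Lemma Psi_perturbation V E U d t : is_spectral V U d -> (forall i, 0 < d 0 i) ->
  E \is symmetricmx -> 0 < t -> (forall i, t + frobenius_norm E <= d 0 i) ->
  posdefmx (V + E) /\
  Psi (V + E) <= Psi V + \tr (mxfun (@dpsi R) V *m E) + ddpsi t / 2 * \tr (E *m E).
Proof.
move=> sV d0 Esym t0 td.
have sVE := eigendecompositionP (symmetricmxD (is_spectral_sym sV) Esym).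
have ev j := eigenvalue_perturbation sV sVE td j; rewrite addrK in ev.
have ev0 j := lt_le_trans t0 (ev j).
split; first exact/(posdefmx_spectral sVE).
have td' i : t <= d 0 i by apply: le_trans (td i); rewrite lerDl sqrtr_ge0.
have := trace_second_order_bound sV sVE (fun i j => psi_le_quadratic t0 (td' i) (ev j)).
have -> : V + E - V = E by rewrite addrAC subrr add0r.
by [].
Qed.

(** Splits [psi], which is not monotone, into convex nondecreasing functions of [x] and of [x^-1],
    up to a constant. *)
Lemma psiE (x : R) : psi x = x ^+ 2 + (x^-1 ^+ 2 / 2 + expR (x^-1 - 1)) - 5 / 2.
Proof. by rewrite /psi -exprVn; lra. Qed.

(** [trace_congruence_mean] needs nonnegative slopes, so it is applied to the square at [V] and to
    [g] at [V^-1]; the inverses of [V1] and [V2] are congruent to [V^-1] by [M'] and its inverse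
    transposed. *)
Lemma Psi_congruence_mean V V1 V2 M : posdefmx V -> posdefmx V1 -> posdefmx V2 ->
  M \in unitmx -> V1 = M^T *m V *m M -> V2 = invmx M *m V *m (invmx M)^T ->
  2 * Psi V <= Psi V1 + Psi V2.
Proof.
move=> /posdefmxP[U [w sV w0]] /posdefmxP[U1 [a s1 a0]] /posdefmxP[U2 [b s2 b0]].
move=> Mu V1E V2E.
rewrite (Psi_spectral sV) (Psi_spectral s1) (Psi_spectral s2).
pose g (x : R) := x ^+ 2 / 2 + expR (x - 1).
have SE (d : 'rV[R]_n) : \sum_i psi (d 0 i) =
    \sum_i d 0 i ^+ 2 + \sum_i g (d 0 i)^-1 - \sum_(i < n) 5 / 2.
  by rewrite -big_split -sumrB; apply: eq_bigr => i _; rewrite psiE.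
rewrite !SE.
have [|Vu sVi] := is_spectral_invmx sV; first by move=> i; rewrite gt_eqF.
have [|V1u s1i] := is_spectral_invmx s1; first by move=> i; rewrite gt_eqF.
have [|V2u s2i] := is_spectral_invmx s2; first by move=> i; rewrite gt_eqF.
have V0 (d : 'rV[R]_n) : (forall i, 0 < d 0 i) -> forall i, 0 < map_mx GRing.inv d 0 i.
  by move=> d0 i; rewrite mxE invr_gt0.
have VE (d : 'rV[R]_n) : \sum_i g (d 0 i)^-1 = \sum_i g (map_mx GRing.inv d 0 i).
  by apply: eq_bigr => i _; rewrite mxE.
pose M' := (invmx M)^T; have M'u : M' \in unitmx by rewrite unitmx_tr unitmx_inv.
have M'V : invmx M' = M^T by rewrite /M' trmx_inv invmxK.
have V1i : invmx V1 = M'^T *m invmx V *m M'.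
  apply: (can_inj (mulKmx V1u)); rewrite mulmxV // V1E /M' trmxK !mulmxA.
  by rewrite mulmxK // mulmxK // -trmx_mul mulVmx // trmx1.
have V2i : invmx V2 = invmx M' *m invmx V *m (invmx M')^T.
  apply: (can_inj (mulKmx V2u)); rewrite mulmxV // V2E M'V trmxK trmx_inv !mulmxA.
  by rewrite mulmxKV ?unitmx_tr // mulmxK // mulVmx.
have hsq : 2 * (\sum_i w 0 i ^+ 2) <= \sum_i a 0 i ^+ 2 + \sum_i b 0 i ^+ 2.
  rewrite V1E in s1; rewrite V2E in s2.
  apply: (trace_congruence_mean (g := fun x => x ^+ 2) (c := fun x => 2 * x) sV w0 Mu s1 a0 s2 b0).
    by move=> x x0; rewrite mulr_ge0 // ltW.
  by move=> x y _ _; have := sqr_ge0 (x - y); nra.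
have hg : 2 * (\sum_i g (w 0 i)^-1) <= \sum_i g (a 0 i)^-1 + \sum_i g (b 0 i)^-1.
  rewrite V1i in s1i; rewrite V2i in s2i; rewrite !VE.
  apply: (trace_congruence_mean (g := g) (c := fun x => x + expR (x - 1)) sVi (V0 _ w0)
           M'u s1i (V0 _ a0) s2i (V0 _ b0)).
    by move=> x x0; rewrite addr_ge0 ?expR_ge0 // ltW.
  move=> x y _ _; rewrite /g.
  have -> : expR (y - 1) = expR (x - 1) * expR (y - x) by rewrite -expRD; congr expR; ring.
  have := ler_wpM2l (expR_ge0 (x - 1)) (expR_ge1Dx (y - x)).
  have := sqr_ge0 (x - y); nra.
lra.
Qed.

End Proximity.

(** * The effect of one inner step and of one update of the barrier parameter *)

Section Iterations.
Variables (R : realType) (n : nat).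
Implicit Types (A B E U W M X Y V D Z Q : 'M[R]_n) (d : 'rV[R]_n) (mu theta tau eps : R).
Implicit Types (L : {linear 'M[R]_n -> 'M[R]_n}).

Lemma frobenius_norm_le E (r : R) : E \is symmetricmx -> 0 <= r ->
  \tr (E *m E) <= r ^+ 2 -> frobenius_norm E <= r.
Proof.
move=> /symmetricmxP ET r0 h; rewrite /frobenius_norm ET.
by rewrite -[leRHS]ger0_norm // -sqrtr_sqr ler_wsqrtr.
Qed.

Lemma inner_step_decrease L Q mu X Y :
  (forall Z, Z \is symmetricmx -> L Z \is symmetricmx) -> monotone_mx L ->
  0 < mu -> strictly_feasible L Q X Y ->
  let XY' := inner_step L mu X Y in let del := delta (scaledV X Y mu) in
  strictly_feasible L Q XY'.1 XY'.2 /\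
  proximity XY'.1 XY'.2 mu <= proximity X Y mu - del ^+ 2 / ddpsi (rho (2 * del)).
Proof.
move=> Lsym Lmono mu0 [Xpos Ypos YE] XY' del.
have [Dpos Vpos XV YV] := scaledV_spec Xpos Ypos mu0.
have [d1s d2s dsum dL] := scaled_direction_spec Lsym Lmono Xpos Ypos mu0.
rewrite mxfun_derive1_psi // in dsum.
rewrite {}/XY' /inner_step /= /proximity.
set D := scalingD X Y in Dpos XV YV dL *; set d := scaled_direction L X Y mu in d1s d2s dsum dL *.
clearbody D d; have Du := posdefmx_unit Dpos.
have del0 : 0 <= del := delta_ge0 _.
have [|t0 t1 _] := @rho_spec R (2 * del); first by rewrite mulr_ge0.
rewrite /default_step -/del derive1n2_psi ?gt_eqF //.
have trsum := mxtrace_dpsi_sqr Vpos; rewrite -/del in trsum.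
have [U [lam sV lam0]] := posdefmxP Vpos.
have lamge i := eigenvalue_ge_rho i sV lam0; rewrite -/del in lamge.
set V := scaledV X Y mu in Vpos XV YV dsum trsum sV *.
set t := rho (2 * del) in t0 t1 lamge *; set c := ddpsi t in lamge *.
have c2 : 2 <= c := ddpsi_ge2 t0; have c0 : 0 < c by lra.
set s := Num.sqrt mu in XV YV *.
have s0 : 0 < s by rewrite sqrtr_gt0.
have scal D' A B (c' : R) : s *: (D' *m (A + c' *: B) *m D') =
    s *: (D' *m A *m D') + c' *: (s *: (D' *m B *m D')).
  rewrite mulmxDr mulmxDl scalerDr -scalemxAr -scalemxAl !scalerA.
  by rewrite [s * _]mulrC.
(* The cross term is nonnegative by monotonicity, so [dd] bounds the squared norm of each direction
   by [4 * del ^+ 2]. *)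
have d12 : 0 <= \tr (d.1 *m d.2) by rewrite -dL; apply: monotone_scaled => //; case: Dpos.
have dd : \tr (d.1 *m d.1) + \tr (d.2 *m d.2) + 2 * \tr (d.1 *m d.2) = 4 * del ^+ 2.
  rewrite -trsum -[LHS]/(_ + _).
  have -> : \tr (mxfun (@dpsi R) V *m mxfun (@dpsi R) V) = \tr ((d.1 + d.2) *m (d.1 + d.2)).
    by rewrite dsum mulNmx mulmxN opprK.
  by rewrite mulmxDl !mulmxDr !raddfD /= [\tr (d.2 *m d.1)]mxtrace_mulC; ring.
have d1ge0 := mxtrace_symmetric_sqr_ge0 d1s; have d2ge0 := mxtrace_symmetric_sqr_ge0 d2s.
have perturb E : E \is symmetricmx -> \tr (E *m E) <= 4 * del ^+ 2 ->
  posdefmx (V + c^-1 *: E) /\ Psi (V + c^-1 *: E) <=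
    Psi V + c^-1 * \tr (mxfun (@dpsi R) V *m E) + c^-1 / 2 * \tr (E *m E).
  move=> Es Ed; have [|p q] := Psi_perturbation sV lam0 (symmetricmxZ c^-1 Es) t0.
    move=> i; apply: le_trans (lamge i); rewrite lerD2l.
    apply: frobenius_norm_le; first exact: symmetricmxZ.
      by apply: divr_ge0; [rewrite mulr_ge0|exact: ltW].
    rewrite -scalemxAl -scalemxAr !mxtraceZ mulrA -expr2 [_ / c]mulrC exprMn.
    by rewrite ler_wpM2l ?sqr_ge0 // exprMn -natrX.
  split=> //; apply: le_trans q _; rewrite -scalemxAl -!scalemxAr !mxtraceZ -/c.
  by rewrite le_eqVlt; apply/orP; left; apply/eqP; field; rewrite gt_eqF.
have [||V1pos V1le] := perturb d.1 => //; first lra.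
have [||V2pos V2le] := perturb d.2 => //; first lra.
set X1 := X + _; set Y1 := Y + _.
have X1E : X1 = s *: (D *m (V + c^-1 *: d.1) *m D).
  by rewrite scal -XV.
have Y1E : Y1 = s *: (invmx D *m (V + c^-1 *: d.2) *m invmx D).
  by rewrite scal -YV.
have X1pos : posdefmx X1 by rewrite X1E; apply/posdefmxZ/posdefmx_congr_sym.
have Y1pos : posdefmx Y1.
  by rewrite Y1E; apply/posdefmxZ/posdefmx_congr_sym/posdefmx_inv.
split.
  have dE : invmx D *m d.2 *m invmx D = L (D *m d.1 *m D).
    by rewrite -dL !mulmxA mulVmx // mul1mx mulmxK.
  have LE : L X1 = L X + c^-1 *: (s *: L (D *m d.1 *m D)).
    by rewrite /X1 linearD; congr (_ + _); rewrite linearZ; congr (_ *: _); rewrite linearZ.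
  by split=> //; rewrite LE -dE addrAC -YE.
have [M Mu [V1E V2E]] := scaledV_update X1pos Y1pos mu0 Dpos X1E Y1E.
have [_ V'pos _ _] := scaledV_spec X1pos Y1pos mu0.
have mean := Psi_congruence_mean V'pos V1pos V2pos Mu V1E V2E.
have trd : \tr (mxfun (@dpsi R) V *m d.1) + \tr (mxfun (@dpsi R) V *m d.2) = - (4 * del ^+ 2).
  by rewrite -raddfD /= -mulmxDr dsum mulmxN raddfN /= trsum.
have ci0 : 0 <= c^-1 by rewrite invr_ge0 ltW.
(* The first-order terms add up to [- 4 del ^+ 2 / c] and the second-order terms to at most
   [2 del ^+ 2 / c]; half of the sum is the claimed decrease. The equations are multiplied by [c^-1]
   to make the goal linear in its monomials. *)
move: mean (lerD V1le V2le) (congr1 (GRing.mul c^-1) trd) (congr1 (GRing.mul c^-1) dd)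
  (mulr_ge0 ci0 d12).
move: (Psi _) (Psi _) (Psi _) (Psi _) (\tr _) (\tr _) (\tr _) (\tr _) (\tr _).
move: (c^-1) (del ^+ 2).
move=> i e q p p1 p2 q1 q2 q3 q4 q5 m1 m2 m3 m4 m5; clear -m1 m2 m3 m4 m5.
lra.
Qed.

Lemma Psi_scale_le V (tau theta : R) : (0 < n)%N -> posdefmx V -> 1 <= tau ->
  0 < theta < 1 -> Psi V <= tau ->
  Psi ((Num.sqrt (1 - theta))^-1 *: V) <=
  2 / (1 - theta) * (Num.sqrt (2 * tau) + Num.sqrt n%:R * theta) ^+ 2.
Proof.
move=> n0 /posdefmxP[U [d sV d0]] tau1 /andP[th0 th1] Vtau.
set w := Num.sqrt (1 - theta).
have w2 : w ^+ 2 = 1 - theta by rewrite sqr_sqrtr //; lra.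
have w0 : 0 < w by rewrite sqrtr_gt0; lra.
have w1 : w < 1 by rewrite -sqrtr1 ltr_sqrt; lra.
set b := w^-1; have wb : w * b = 1 by rewrite mulfV // gt_eqF.
have b1 : 1 <= b by rewrite invf_ge1 // ltW.
have b2 : b ^+ 2 * (1 - theta) = 1 by rewrite -w2 -exprMn mulrC wb expr1n.
have b20 : 0 < b ^+ 2 by rewrite exprn_gt0 // invr_gt0.
have -> : 2 / (1 - theta) = 2 * b ^+ 2 by rewrite -w2 /b exprVn.
rewrite (Psi_spectral (is_spectralZ b sV)).
rewrite (Psi_spectral sV) in Vtau.
under eq_bigr do rewrite mxE.
set P := \sum_i _ in Vtau.
have P0 : 0 <= P by apply: sumr_ge0 => i _; exact: psi_ge0.
set x := Num.sqrt tau; set y := Num.sqrt (n%:R : R).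
have x2 : x ^+ 2 = tau by rewrite sqr_sqrtr //; lra.
have y2 : y ^+ 2 = n%:R by rewrite sqr_sqrtr.
have x0 : 0 < x by rewrite sqrtr_gt0; lra.
have y0 : 0 < y by rewrite sqrtr_gt0 ltr0n.
have -> : Num.sqrt (2 * tau) = Num.sqrt 2 * x by rewrite sqrtrM.
set r := Num.sqrt 2.
have r2 : r ^+ 2 = 2 by rewrite sqr_sqrtr.
have r0 : 0 < r by rewrite sqrtr_gt0.
(* This weight balances the two halves of [amgm_weighted]: [n * k] equals [x * y], and [P / k] is at
   most [x * y]. *)
pose k := x / y; have k0 : 0 < k by rewrite divr_gt0.
have nk : n%:R * k = x * y by rewrite -y2 /k; field; rewrite gt_eqF.
have Pk : P / k <= x * y.
  rewrite ler_pdivrMr //; apply: le_trans Vtau _; rewrite -x2 /k.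
  by rewrite le_eqVlt; apply/orP; left; apply/eqP; field; rewrite gt_eqF.
have sumc (c : R) : \sum_(i < n) c = n%:R * c by rewrite sumr_const card_ord mulr_natl.
have [th|th] := leP theta (4 / 5).
  apply: le_trans (_ : \sum_i 4 * ((b - 1) ^+ 2 +
     (b - 1) * b * (k + psi (d 0 i) / k) + b ^+ 2 * psi (d 0 i)) <= _).
    by apply: ler_sum => i _; exact: psi_scale_le_quadratic.
  rewrite -mulr_sumr !big_split /= sumc -mulr_sumr big_split /= sumc -mulr_suml.
  rewrite -mulr_sumr -/P nk.
  have -> : r * x + y * theta = r * (x + y * theta / r) by field; rewrite gt_eqF.
  rewrite exprMn r2.
  have bth : b - 1 <= b * (theta / r).
    have -> : b - 1 = b * (1 - w) by rewrite mulrBr mulr1 [b * w]mulrC wb.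
    by apply: ler_wpM2l; [lra | exact: one_sub_sqrt_le].
  apply: le_trans (_ : 4 * ((b - 1) * y + b * x) ^+ 2 <= _).
    rewrite ler_pM2l // -y2.
    have h1 : (b - 1) * b * (x * y + P / k) <= (b - 1) * b * (x * y + x * y).
      by rewrite ler_wpM2l ?lerD2l // mulr_ge0 // ?subr_ge0 // (le_trans _ b1).
    have h2 : b ^+ 2 * P <= b ^+ 2 * x ^+ 2 by rewrite ler_pM2l // x2.
    lra.
  have -> : 2 * b ^+ 2 * (2 * (x + y * theta / r) ^+ 2) =
    4 * (b * (theta / r) * y + b * x) ^+ 2 by ring.
  have bge0 : 0 <= b by lra.
  have bm : 0 <= b - 1 by lra.
  have tr0 : 0 <= theta / r by apply: divr_ge0; exact: ltW.
  have xge0 := ltW x0; have yge0 := ltW y0.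
  rewrite ler_pM2l //; apply: lerXn2r.
  - by apply: addr_ge0 => //; apply: mulr_ge0.
  - by apply: addr_ge0 => //; apply: mulr_ge0 => //; apply: mulr_ge0.
  - by rewrite lerD2r; apply: ler_wpM2r.
apply: le_trans (_ : \sum_i (psi (d 0 i) + (b ^+ 2 - 1) * (1 + k + psi (d 0 i) / k + psi (d 0 i))) <= _).
  apply: ler_sum => i _; apply: le_trans (psi_scale_le (d0 i) b1) _.
  rewrite lerD2l; apply: ler_wpM2l; first by rewrite subr_ge0 exprn_ege1.
  have u2 := psi_ge_sqr (d0 i); have := amgm_weighted k0 u2; lra.
rewrite big_split /= -/P -mulr_sumr 3!big_split /= -/P !sumc -mulr_suml -/P nk mulr1 -y2.
have h1 : (b ^+ 2 - 1) * (y ^+ 2 + x * y + P / k + P) <=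
    (b ^+ 2 - 1) * (y ^+ 2 + x * y + x * y + x ^+ 2).
  by apply: ler_wpM2l; [rewrite subr_ge0 exprn_ege1 | lra].
have -> : 2 * b ^+ 2 * (r * x + y * theta) ^+ 2 =
    2 * b ^+ 2 * (r ^+ 2 * x ^+ 2 + 2 * r * x * y * theta + y ^+ 2 * theta ^+ 2) by ring.
have bE : b ^+ 2 - 1 = b ^+ 2 * theta by lra.
have xE : x ^+ 2 = b ^+ 2 * ((1 - theta) * x ^+ 2) by rewrite mulrA b2 mul1r.
apply: le_trans (_ : b ^+ 2 * ((1 - theta) * x ^+ 2 + theta * (y ^+ 2 + x * y + x * y + x ^+ 2)) <= _).
  rewrite [leRHS]mulrDr -xE [b ^+ 2 * (theta * _)]mulrA -bE; lra.
rewrite [2 * b ^+ 2]mulrC -[leRHS]mulrA ler_pM2l // r2.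
have xy0 : 0 <= x * y by rewrite mulr_ge0 // ltW.
have h2 : theta * y ^+ 2 <= 2 * (y ^+ 2 * theta ^+ 2).
  have -> : 2 * (y ^+ 2 * theta ^+ 2) = theta * y ^+ 2 * (2 * theta) by ring.
  by apply: ler_peMr; [exact: mulr_ge0 (ltW th0) (sqr_ge0 _) | lra].
have h3 : theta * (x * y) <= r * x * y * theta.
  have -> : r * x * y * theta = r * (theta * (x * y)) by ring.
  have r1 : 1 <= r by rewrite -[1]sqrtr1; apply: ler_wsqrtr; lra.
  by apply: ler_peMl => //; apply: mulr_ge0 => //; exact: ltW.
have x20 := sqr_ge0 x; have h4 := mulr_ge0 (ltW th0) xy0.
lra.
Qed.

End Iterations.

(** * Counting the inner and outer iterations *)

Section Complexity.
Variables (R : realType) (n : nat).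
Implicit Types (X Y Z Q : 'M[R]_n) (mu theta tau eps p : R).
Implicit Types (L : {linear 'M[R]_n -> 'M[R]_n}).

Lemma proximity_mulmu X Y mu theta : theta < 1 ->
  proximity X Y ((1 - theta) * mu) =
  Psi ((Num.sqrt (1 - theta))^-1 *: scaledV X Y mu).
Proof.
by move=> th1; rewrite /proximity /scaledV scalerA -invfM sqrtrM //; lra.
Qed.

Lemma proximity_ge0 X Y mu : 0 < mu -> posdefmx X -> posdefmx Y ->
  0 <= proximity X Y mu.
Proof.
by move=> mu0 Xpos Ypos; have [_ Vpos _ _] := scaledV_spec Xpos Ypos mu0; exact: Psi_ge0.
Qed.

Lemma mxtrace_mul_posdef_gt0 X Y : (0 < n)%N -> posdefmx X -> posdefmx Y ->
  0 < \tr (X *m Y).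
Proof.
move=> n0 Xpos Ypos; have [Dpos Vpos] := scaledV_spec Xpos Ypos ltr01.
have Du := posdefmx_unit Dpos.
rewrite sqrtr1 !scale1r; move: Dpos Vpos Du.
move: (scalingD X Y) (scaledV X Y 1) => D V _ /posdefmxP[U [d sV d0]] Du -> ->.
rewrite -!mulmxA (mulmxA D (invmx D)) mulmxV // mul1mx mxtrace_mulC -!mulmxA mulVmx //.
rewrite mulmx1 (mxtrace_spectral (is_spectral_mul sV sV)).
rewrite (bigD1 (Ordinal n0)) //= ltr_pwDl //; first by rewrite mxE mulr_gt0.
by apply: sumr_ge0 => i _; rewrite mxE mulr_ge0 // ltW.
Qed.

(** [p - k * sqrt p <= (sqrt p - k / 2) ^+ 2]; since [p' >= 0] forces [k <= sqrt p], the base of the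
    square is nonnegative. *)
Lemma sqrt_decrease p p' (k : R) : 0 <= p' -> 0 <= k -> 0 < p ->
  p' <= p - k * Num.sqrt p -> Num.sqrt p' <= Num.sqrt p - k / 2.
Proof.
move=> p'0 k0 p0 le.
set x := Num.sqrt p in le *; have x0 : 0 < x by rewrite sqrtr_gt0.
have x2 : x ^+ 2 = p by rewrite sqr_sqrtr // ltW.
have kx : k <= x by rewrite -(ler_pM2r x0) -expr2 x2; lra.
have h : 0 <= x - k / 2 by lra.
rewrite -[leRHS]ger0_norm // -sqrtr_sqr; apply: ler_wsqrtr.
by apply: le_trans le _; rewrite -x2; nra.
Qed.

Definition log_factor p : R := 1 + ln (2 * Num.sqrt (2 * p) + 1).

Lemma log_factor_ge1 p : 1 <= log_factor p.
Proof. by rewrite /log_factor lerDl ln_ge0 // lerDr mulr_ge0 // sqrtr_ge0. Qed.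

Lemma log_factor_le p q : 0 <= p -> p <= q -> log_factor p <= log_factor q.
Proof.
move=> p0 pq; rewrite lerD2l ler_ln ?posrE.
- by rewrite lerD2r; apply: ler_wpM2l => //; apply: ler_wsqrtr; rewrite ler_pM2l.
- by rewrite ltr_wpDl // mulr_ge0 // sqrtr_ge0.
- by rewrite ltr_wpDl // mulr_ge0 // sqrtr_ge0.
Qed.

(** The potential [C * sqrt Psi] falls by at least 1 per iteration. The logarithm is frozen at the
    upper bound [p], so that [C] is the same for all iterations. *)
Lemma inner_loop_bound L Q tau mu p X Y :
  (forall Z, Z \is symmetricmx -> L Z \is symmetricmx) -> monotone_mx L ->
  1 <= tau -> 0 < mu -> strictly_feasible L Q X Y -> proximity X Y mu <= p ->
  exists XY' k, [/\ inner_loop L tau mu (X, Y) XY' k,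
    strictly_feasible L Q XY'.1 XY'.2, proximity XY'.1 XY'.2 mu <= tau
    & k%:R <= 29 * log_factor p ^+ 2 * Num.sqrt (proximity X Y mu)].
Proof.
move=> Lsym Lmono tau1 mu0.
have l0 : 0 < log_factor p := lt_le_trans ltr01 (log_factor_ge1 p).
set C := 29 * log_factor p ^+ 2; have C0 : 0 < C by rewrite mulr_gt0 // exprn_gt0.
have stop X1 Y1 : strictly_feasible L Q X1 Y1 -> proximity X1 Y1 mu <= tau ->
    exists XY' k, [/\ inner_loop L tau mu (X1, Y1) XY' k,
      strictly_feasible L Q XY'.1 XY'.2, proximity XY'.1 XY'.2 mu <= tau
      & k%:R <= C * Num.sqrt (proximity X1 Y1 mu)].
  move=> feas le; exists (X1, Y1), 0%N; split=> //; first exact: inner_stop.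
  by rewrite mulr_ge0 ?sqrtr_ge0 // ltW.
move=> feas0 le0.
(* [m] is the fuel of the induction; with no fuel left the proximity vanishes, hence is below
   [tau]. *)
have [m] : exists m : nat, C * Num.sqrt (proximity X Y mu) <= m%:R.
  exists (Num.bound (C * Num.sqrt (proximity X Y mu))).
  by apply/ltW/archi_boundP; rewrite mulr_ge0 ?sqrtr_ge0 // ltW.
elim: m X Y feas0 le0 => [|m IHm] X Y feas le lem.
  apply: stop => //; apply: le_trans (le_trans ler01 tau1).
  rewrite leNgt; apply: contraTN lem => gt0.
  by rewrite -ltNge mulr_gt0 // sqrtr_gt0.
have /orP[ptau|gt] := orNb (tau < proximity X Y mu).
  by apply: stop feas _; rewrite leNgt.
have [Xpos Ypos _] := feas.
have [_ Vpos _ _] := scaledV_spec Xpos Ypos mu0.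
have := inner_step_decrease Lsym Lmono mu0 feas; cbv zeta.
case stepE : (inner_step L mu X Y) => [X1 Y1]; rewrite /fst /snd => -[feas1 dec].
have [X1pos Y1pos _] := feas1.
have p1 := le_trans tau1 (ltW gt); have pgt0 := lt_le_trans ltr01 p1.
have dle := default_decrease_ge p1 (sqrt_Psi_le_delta Vpos).
have Cle : 2 / C <= 2 / (29 * log_factor (proximity X Y mu) ^+ 2).
  have l1 : 0 < log_factor (proximity X Y mu) := lt_le_trans ltr01 (log_factor_ge1 _).
  apply: ler_wpM2l => //; rewrite lef_pV2 ?posrE ?mulr_gt0 ?exprn_gt0 //.
  rewrite ler_pM2l //; apply: lerXn2r; last exact: log_factor_le (ltW pgt0) le.
    by rewrite nnegrE ltW.
  by rewrite nnegrE ltW.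
have h := le_trans (ler_wpM2r (sqrtr_ge0 (proximity X Y mu)) Cle) dle.
have dec' : proximity X1 Y1 mu <= proximity X Y mu - 2 / C * Num.sqrt (proximity X Y mu).
  exact: (le_trans dec (lerB (lexx (proximity X Y mu)) h)).
have C2 : 0 <= 2 / C by rewrite divr_ge0 // ltW.
have := sqrt_decrease (proximity_ge0 mu0 X1pos Y1pos) C2 pgt0 dec'.
rewrite mulrAC divff // mul1r => sdec.
have Cdec : C * Num.sqrt (proximity X1 Y1 mu) + 1 <= C * Num.sqrt (proximity X Y mu).
  rewrite -lerBrDr; have := ler_wpM2l (ltW C0) sdec.
  by rewrite mulrBr mulfV ?gt_eqF.
have [||XY' [k [loop feas' prox' kle]]] := IHm X1 Y1 feas1.
- apply: le_trans dec' _; apply: le_trans le; rewrite gerBl.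
  by rewrite mulr_ge0 // sqrtr_ge0.
- by rewrite -(lerD2r 1) natr1; exact: le_trans Cdec lem.
exists XY', k.+1; split; [|exact: feas'|exact: prox'|].
  by apply: (inner_iter gt); rewrite stepE; exact: loop.
by rewrite -natr1; apply: le_trans Cdec; rewrite lerD2r.
Qed.

(** Since [(1 - theta) ^+ m <= expR (- theta * m)] and [expR (theta * m) >= 1 + theta * m], any
    [m > q / theta] works. This gives termination of the outer loop. *)
Lemma geometric_lt_inv theta (q : R) : 0 < theta < 1 -> 0 < q ->
  exists m : nat, (1 - theta) ^+ m < q^-1.
Proof.
move=> /andP[th0 th1] q0.
have qth : 0 <= q / theta by apply: divr_ge0; exact: ltW.
have := archi_boundP qth; set m := Num.bound _ => mq; exists m.
rewrite -[ltLHS]invrK ltf_pV2 ?posrE ?invr_gt0 ?exprn_gt0 //; last lra.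
apply: lt_le_trans (_ : expR (theta * m%:R) <= _).
  rewrite ltr_pdivrMr // mulrC in mq.
  by have := expR_ge1Dx (theta * m%:R); lra.
rewrite -[leLHS]invrK lef_pV2 ?posrE ?invr_gt0 ?expR_gt0 ?exprn_gt0 //; last lra.
rewrite -expRN -mulNr expRM_natr.
apply: lerXn2r; rewrite ?nnegrE ?expR_ge0 //; first lra.
by have := expR_ge1Dx (- theta); lra.
Qed.

(** The conditional factor bounds the number of outer iterations and is shaped for the induction: it
    is 0 once the loop has stopped, where the logarithm may be negative. *)
Lemma ipm_run_bound L Q tau theta eps mu (Psi0 : R) X Y : (0 < n)%N ->
  (forall Z, Z \is symmetricmx -> L Z \is symmetricmx) -> monotone_mx L ->
  1 <= tau -> 0 < eps -> 0 < theta < 1 ->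
  Psi0 = 2 / (1 - theta) * (Num.sqrt (2 * tau) + Num.sqrt n%:R * theta) ^+ 2 ->
  0 < mu -> strictly_feasible L Q X Y -> proximity X Y mu <= tau ->
  exists2 N, ipm_run L tau theta eps mu (X, Y) N &
    N%:R <= 29 * log_factor Psi0 ^+ 2 * Num.sqrt Psi0 *
      (if eps <= n%:R * mu then 1 + theta^-1 * ln (n%:R * mu / eps) else 0).
Proof.
move=> n0 Lsym Lmono tau1 eps0 th01 Psi0E; have /andP[th0 th1] := th01.
have w0 : 0 < 1 - theta by lra.
have nR0 : 0 < n%:R :> R by rewrite ltr0n.
set C := 29 * _ * _.
have C0 : 0 <= C.
  rewrite /C mulr_ge0 ?sqrtr_ge0 // mulr_ge0 // exprn_ge0 //.
  exact: le_trans ler01 (log_factor_ge1 _).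
move=> mu0 feas prox.
have [m] : exists m : nat, n%:R * ((1 - theta) ^+ m * mu) < eps.
  have q0 : 0 < n%:R * mu / eps by rewrite divr_gt0 // mulr_gt0.
  have [m mle] := geometric_lt_inv th01 q0; exists m.
  by rewrite mulrCA -ltr_pdivlMr ?mulr_gt0 // (lt_le_trans mle) // invf_div.
elim: m mu X Y mu0 feas prox => [|m IHm] mu X Y mu0 feas prox small.
  rewrite expr0 mul1r in small; exists 0%N; first exact: run_stop.
  have -> : (eps <= n%:R * mu) = false by apply/negbTE; rewrite -ltNge.
  by rewrite mulr0.
have [run|stop] := leP eps (n%:R * mu); last first.
  by exists 0%N; [exact: run_stop | rewrite mulr0].
have mu'0 : 0 < (1 - theta) * mu by rewrite mulr_gt0.
have [Xpos Ypos _] := feas; have [_ Vpos _ _] := scaledV_spec Xpos Ypos mu0.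
have prox0 : proximity X Y ((1 - theta) * mu) <= Psi0.
  by rewrite proximity_mulmu // Psi0E; exact: Psi_scale_le.
have [[X1 Y1] [k [loop feas1 prox1 kle]]] :=
  inner_loop_bound Lsym Lmono tau1 mu'0 feas prox0.
have [|N runN Nle] := IHm _ X1 Y1 mu'0 feas1 prox1; first by rewrite [_ ^+ m * _]mulrA -exprSr.
exists (k + N)%N; first exact: run_outer loop runN.
have kC : k%:R <= C.
  apply: le_trans kle _; rewrite /C; apply: ler_wpM2l; last exact: ler_wsqrtr.
  by rewrite mulr_ge0 ?sqr_ge0.
have NC : N%:R <= C * (theta^-1 * ln (n%:R * mu / eps)).
  apply: le_trans Nle _; apply: ler_wpM2l => //.
  have q1 : 1 <= n%:R * mu / eps by rewrite ler_pdivlMr // mul1r.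
  have q0 : 0 < n%:R * mu / eps := lt_le_trans ltr01 q1.
  have th'0 : 0 <= theta^-1 by rewrite invr_ge0 ltW.
  case: ifP => _; last by rewrite mulr_ge0 // ln_ge0.
  have -> : n%:R * ((1 - theta) * mu) / eps = (1 - theta) * (n%:R * mu / eps) by ring.
  rewrite [ln ((1 - theta) * _)]lnM ?posrE // mulrDr addrA gerDr.
  (* One outer iteration lowers [theta^-1 * ln (n%:R * mu / eps)] by at least 1, which pays for the
     summand 1. *)
  have hl : ln (1 - theta) <= - theta.
    by apply: le_trans (ln_le_sub1 w0) _; rewrite addrAC subrr sub0r.
  have := ler_wpM2l th'0 hl; rewrite mulrN mulVf ?lt0r_neq0 // => h.
  by rewrite -lerBrDl sub0r.
by rewrite /= natrD mulrDr mulr1 lerD.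
Qed.

End Complexity.

(** The maximum with 1 accounts for the outer iteration that is run already at [n%:R * mu0 = eps],
    where the logarithm is 0. As [ipm_run] is inductive, exhibiting a run includes termination. *)
Theorem theorem5 (R : realType) (n : nat) (n_gt0 : (0 < n)%N)
    (L : {linear 'M[R]_n -> 'M[R]_n})
    (L_sym : forall Z : 'M[R]_n, Z \is symmetricmx -> L Z \is symmetricmx)
    (L_mono : monotone_mx L)
    (Q : 'M[R]_n) (Q_sym : Q \is symmetricmx)
    (problem_strictly_feasible :
       exists X Y : 'M[R]_n, strictly_feasible L Q X Y)
    (tau eps theta : R) (eps_gt0 : 0 < eps) (theta_01 : 0 < theta < 1)
    (X0 Y0 : 'M[R]_n) (mu0 : R)
    (start_feasible : strictly_feasible L Q X0 Y0)
    (mu0E : mu0 = \tr (X0 *m Y0) / n%:R)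
    (start_prox : proximity X0 Y0 mu0 <= tau)
    (Psi0 : R)
    (Psi0E : Psi0 = 2 / (1 - theta)
                    * (Num.sqrt (2 * tau) + Num.sqrt n%:R * theta) ^+ 2)
    (tau_ge1 : 1 <= tau) :
  exists2 N : nat,
    ipm_run L tau theta eps mu0 (X0, Y0) N &
    N%:R <= 66 * (1 + ln (2 * Num.sqrt (2 * Psi0) + 1)) ^+ 2 * Num.sqrt Psi0
            * Num.max 1 (theta^-1 * ln (n%:R * mu0 / eps)).
Proof.
have [X0pos Y0pos _] := start_feasible.
have mu0_gt0 : 0 < mu0.
  by rewrite mu0E divr_gt0 ?ltr0n //; exact: mxtrace_mul_posdef_gt0.
have [N run Nle] := ipm_run_bound n_gt0 L_sym L_mono tau_ge1 eps_gt0 theta_01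
  Psi0E mu0_gt0 start_feasible start_prox.
exists N; first exact: run.
apply: le_trans Nle _; rewrite -/(log_factor Psi0).
set A := log_factor Psi0 ^+ 2; set B := Num.sqrt Psi0.
set x := theta^-1 * _; set K := Num.max 1 x.
have A0 : 0 <= A := sqr_ge0 _; have B0 : 0 <= B := sqrtr_ge0 _.
have AB0 : 0 <= A * B := mulr_ge0 A0 B0.
have K1 : 1 <= K by rewrite le_max lexx.
have xK : x <= K by rewrite le_max lexx orbT.
(* With [x <= K] and [1 <= K], the outer count [1 + x] is at most [2 * K], and 2 * 29 = 58 stays
   below 66. *)
have -> : 66 * A * B * K = 29 * A * B * (66 / 29 * K) by field.
apply: ler_wpM2l; first by rewrite -mulrA; apply: mulr_ge0.
by case: ifP => _; lra.
Qed.
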